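(* Let $A\in\mathcal{A}_{n,1}$, $(N,E)=\Lambda(A)$, let $(k;a_1,\dots,a_n;b,\beta)$ be the generalized inversion table of $(N,E)$ and $\Omega=(\omega_1,\dots,\omega_n)=\Phi(N,E)$. Then: (1) $r(A)=r(N)=a_n$, which equals the number of $E$-steps of $\Omega$ lying at height $n$ (i.e. both endpoints have $y$-coordinate $n$); all of them belong to $\omega_n$; (2) $i(A)=i(N)=a_1+\dots+a_n+b+1$, which equals the total number of $E$-steps and $N$-steps of $\Omega$; (3) $E(A)=E=a_{k-1}+\beta+1-a_k$, which equals the $x$-coordinate of the end vertex of the unique $N$-step of $\Omega$ minus the $x$-coordinate of the start vertex of the unique $S$-step of $\Omega$ (both vertices lie at height $k$); (4) $B(A)=B(N)-E=b-\beta$; (5) $J(A)=J(N)=a_k-a_{k-1}+b$, which equals the distance between the junctions of $\omega_{k-1}$ and $\omega_k$ (both at height $k-1$).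
   Context: An alternating sign matrix (ASM) of order $n$ is an $n\times n$ matrix $A=(a_{ij})$ with entries in $\{-1,0,1\}$ such that in every row and every column the nonzero entries alternate in sign, the first and the last nonzero entries being $1$. $\mathcal{A}_{n,s}$ denotes the set of order-$n$ ASMs having exactly $s$ entries equal to $-1$ (so $\mathcal{A}_{n,0}$ is the set of $n\times n$ permutation matrices). For an ASM $A=(a_{ij})$: $r(A)$ is the number of entries of the first row lying to the left of its unique nonzero entry (which is a $1$); $i(A)=\sum a_{ij}a_{k\ell}$, the sum over all pairs of positions with $k>i$ and $\ell<j$ (number of inversions); $\overline{A}=(a_{i,n+1-j})$ is the vertical reflection of $A$. Let $A\in\mathcal{A}_{n,1}$. The opening column is the column containing the unique $-1$; the closing row is the row containing the $-1$; the opening row is the row of the $1$ of the opening column lying above the $-1$. The columns strictly to the left (resp. right) of the opening column form the left side (resp. right side). The closing row contains exactly two $1$'s, one in each side; the one in the right side is the closing $1$ and its column is the closing column. The rows strictly between the opening row and the closing row are the enclosed rows. $A$ is neutral if there are no enclosed rows; otherwise $A$ is positive if the $1$ of the lowest enclosed row lies in the right side, and negative if it lies in the left side. $\mathcal{A}_{n,1}^{+},\mathcal{A}_{n,1}^{0},\mathcal{A}_{n,1}^{-}$ denote the sets of positive, neutral, negative elements of $\mathcal{A}_{n,1}$; $A$ is negative iff $\overline{A}$ is positive. For $A\in\mathcal{A}_{n,1}^{+}\cup\mathcal{A}_{n,1}^{0}$: the charged cell is the intersection of the enclosed rows with the right side; the extended neutral cell is the intersection of the rows from the opening row to the closing row (inclusive)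 with the left side. The leading $1$ is the highest $1$ in the left side strictly below the opening row; its column is the leading column; the leading cell consists of the entries strictly below the opening row and strictly between the leading column and the opening column, and $\ell(A)$ is the sum of its entries. The closing cell consists of the entries strictly below the closing row and strictly between the opening column and the closing column, and $c(A)$ is the sum of its entries; the extended closing cell consists of the entries strictly below the closing row in the columns from the opening column to the closing column inclusive. Parameters: if $A$ is positive, $E(A)$ is the sum of the entries of the charged cell; if $A$ is neutral, $E(A)=0$; if $A$ is negative, $E(A)=-E(\overline{A})$. For $A\in\mathcal{A}_{n,1}^{+}\cup\mathcal{A}_{n,1}^{0}$, $B(A)=c(A)-\ell(A)$ and $J(A)=c(A)+\ell(A)+|E(A)|+1$; for $A\in\mathcal{A}_{n,1}^{-}$, $B(A)=-B(\overline{A})$ and $J(A)=J(\overline{A})$. Horizontal displacement: for an $m\times q$ $(0,1)$-matrix $P$ whose nonzero columns are $j_1<\dots<j_t$ with $j_1=1$ and $j_t<q$, $H(P)$ is the $m\times q$ matrix whose column $j_{s+1}$ equals column $j_s$ of $P$ for $1\le s\le t$ (where $j_{t+1}=q$), all other columns being zero. Vertical displacement: for an $m\times q$ $(0,1)$-matrix $P$ whose nonzero rows are $i_1<\dots<i_t$ with $i_1>1$ and $i_t=m$, $V(P)$ is the $m\times q$ matrix whose row $i_{s-1}$ equals row $i_s$ of $P$ for $1\le s\le t$ (where $i_0=1$), all other rows being zero. Partial discharging procedure: for $A\in\mathcal{A}_{n,1}^{+}\cup\mathcal{A}_{n,1}^{0}$, $\delta(A)$ is obtained by applying successively the following steps (all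 cells, rows and columns referring to the positions they occupy in $A$): (1) replace the $-1$ and the closing $1$ by $0$; (2) replace the submatrix occupying the extended closing cell by its image under $H$; (3) replace the submatrix occupying the extended neutral cell by its image under $V$; (4) lower the entries of the extended neutral cell and of the charged cell by one row: in the left side, for each row $t$ strictly below the opening row up to and including the closing row, the left part of row $t$ becomes the former left part of row $t-1$, and the left part of the opening row becomes zero; in the right side, for each row $t$ from two rows below the opening row up to and including the closing row, the right part of row $t$ becomes the former right part of row $t-1$, and the right part of the row immediately below the opening row becomes zero. The complete discharging procedure is $\Delta(A)=(k,\delta(A),c(A),E(A))$, where $k$ is the index of the opening row of $A$. It is known that $\Delta$ is injective on $\mathcal{A}_{n,1}^{+}\cup\mathcal{A}_{n,1}^{0}$, and that whenever $\Delta(A)=(k,P,c,E)$, there is a unique $N\in\mathcal{A}_{n,1}^{+}\cup\mathcal{A}_{n,1}^{0}$ with $\Delta(N)=(k,P,c+E,0)$, and this $N$ is neutral. Neutralizing procedure $\Lambda$: for $A\in\mathcal{A}_{n,1}^{+}\cup\mathcal{A}_{n,1}^{0}$ with $\Delta(A)=(k,P,c,E)$, $\Lambda(A)=(N,E)$ where $N$ is the unique element with $\Delta(N)=(k,P,c+E,0)$. For $A\in\mathcal{A}_{n,1}^{-}$, write $\Lambda(\overline{A})=(M,-E)$ and set $\Lambda(A)=(\overline{M},E)$. $\Lambda$ takes values in $\mathcal{N}_{n,1}=\{(N,E)\,:\,N\in\mathcal{A}_{n,1}^{0},\ E\in\mathbb{Z},\ -\ell(N)\le E\le c(N)\}$.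 Generalized inversion table: for $(N,E)\in\mathcal{N}_{n,1}$, let $n+1-k$ be the index of the opening row of $N$ (so the closing row is row $n+2-k$). For $1\le i\le n$, $a_i$ is the sum of the entries of $N$ lying strictly below row $n+1-i$ and strictly to the left of the unique $1$ of row $n+1-i$ (for $i=k-1$, i.e. the closing row, the leftmost $1$ of that row is used). Let $b=c(N)$ and $\beta=E+\ell(N)$. The generalized inversion table of $(N,E)$ is $(k;a_1,\dots,a_n;b,\beta)$. Mixed configurations: let $\mathcal{G}_n=\{(x,y)\in\mathbb{Z}^2: 0\le x<y\le n\}$. Steps are $E=(1,0)$, $F=(1,0)$ (a distinct letter from $E$ with the same displacement), $S=(0,-1)$, $N=(1,1)$. A mixed path is a lattice path all of whose vertices lie in $\mathcal{G}_n$, given as a word $LR$ where the Left part $L$ is a word in $\{S,E\}$ and the Right part $R$ is a word in $\{F,N\}$; the vertex where $L$ ends and $R$ begins is the junction. An order-$n$ mixed configuration is a sequence $(\omega_1,\dots,\omega_n)$ of mixed paths such that for some permutation $\sigma$ of $\{1,\dots,n\}$, $\omega_i$ starts at $(0,i)$ and ends at $(\sigma(i)-1,\sigma(i))$, the Left parts are pairwise vertex-disjoint, and the Right parts are pairwise vertex-disjoint. $\mathcal{M}_{n,s}$ is the set of order-$n$ mixed configurations containing exactly $s$ $N$-steps in total. For $(N,E)\in\mathcal{N}_{n,1}$ with generalized inversion table $(k;a_1,\dots,a_n;b,\beta)$, $\Phi(N,E)=(\omega_1,\dots,\omega_n)$ where $\omega_i=E^{a_i}F^{i-1-a_i}$ for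 $i\notin\{k-1,k\}$, $\omega_{k-1}=E^{a_{k-1}}F^{\beta}NF^{k-2-a_{k-1}-\beta}$, and $\omega_k=E^{a_k}SE^{b}F^{k-2-a_k-b}$ (exponents denote repetition of steps; $\omega_i$ starts at $(0,i)$). *)

(* Defs.v *)
From HB Require Import structures.
From mathcomp Require Import all_boot all_order all_algebra.
Set Implicit Arguments.
Unset Strict Implicit.
Unset Printing Implicit Defensive.
Import Order.TTheory GRing.Theory Num.Theory.
Local Open Scope ring_scope.

(* Matrices: an order-n matrix is A : 'M[int]_n.  For readability all
   combinatorial definitions use 1-based indices (as in the paper) via
   the accessor [ent A i j] (= a_{ij} for 1 <= i,j <= n, 0 otherwise). *)

Definition mat := nat -> nat -> int.

Definition ent n (A : 'M[int]_n) : mat := fun i j =>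
  match (insub i.-1 : option 'I_n), (insub j.-1 : option 'I_n) with
  | Some i', Some j' => if (0 < i)%N && (0 < j)%N then A i' j' else 0
  | _, _ => 0
  end.

Definition of_mat n (M : mat) : 'M[int]_n := \matrix_(i < n, j < n) M i.+1 j.+1.

Definition cellsum (M : mat) (i1 i2 j1 j2 : nat) : int :=
  \sum_(i1 <= i < i2) \sum_(j1 <= j < j2) M i j.

Definition alt_seq (s : seq int) : bool :=
  odd (size s) && all (fun k => nth 0 s k == (-1) ^+ k) (iota 0 (size s)).

Definition is_ASM n (A : 'M[int]_n) : bool :=
  [&& [forall i, forall j, A i j \in [:: 0; 1; -1]],
      [forall i : 'I_n, alt_seq [seq x <- [seq A i j | j <- enum 'I_n] | x != 0]] &
      [forall j : 'I_n, alt_seq [seq x <- [seq A i j | i <- enum 'I_n] | x != 0]]].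

Definition num_neg n (A : 'M[int]_n) : nat :=
  #|[set ij : 'I_n * 'I_n | A ij.1 ij.2 == -1]|.

Definition in_ASM n (s : nat) (A : 'M[int]_n) : bool := is_ASM A && (num_neg A == s).

Definition vrefl n (A : 'M[int]_n) : 'M[int]_n := \matrix_(i, j) A i (rev_ord j).

Definition rpar n (A : 'M[int]_n) : nat := find (fun j => ent A 1 j != 0) (iota 1 n).

Definition ipar n (A : 'M[int]_n) : int :=
  \sum_(i < n) \sum_(j < n) \sum_(k < n) \sum_(l < n | (i < k)%N && (l < j)%N)
     A i j * A k l.

Section OneNeg.
Variables (n : nat) (A : 'M[int]_n).
Let a := ent A.

Definition close_row : nat :=
  head 0%N [seq i <- iota 1 n | has (fun j => a i j == -1) (iota 1 n)].
Definition open_col : nat :=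
  head 0%N [seq j <- iota 1 n | has (fun i => a i j == -1) (iota 1 n)].
Definition open_row : nat :=
  last 0%N [seq i <- iota 1 close_row.-1 | a i open_col == 1].
Definition close_col : nat :=
  head 0%N [seq j <- iota open_col.+1 (n - open_col) | a close_row j == 1].
Definition one_col (i : nat) : nat := head 0%N [seq j <- iota 1 n | a i j == 1].

Definition is_neutral : bool := (open_row.+1 == close_row).
Definition is_positive : bool :=
  (open_row.+1 < close_row)%N && (open_col < one_col close_row.-1)%N.
Definition is_negative : bool :=
  (open_row.+1 < close_row)%N && (one_col close_row.-1 < open_col)%N.

Definition charge : int := cellsum a open_row.+1 close_row open_col.+1 n.+1.

Definition lead_row : nat :=
  head 0%N [seq i <- iota open_row.+1 (n - open_row)
           | has (fun j => a i j == 1) (iota 1 open_col.-1)].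
Definition lead_col : nat :=
  head 0%N [seq j <- iota 1 open_col.-1 | a lead_row j == 1].

Definition lpar : int := cellsum a open_row.+1 n.+1 lead_col.+1 open_col.
Definition cpar : int := cellsum a close_row.+1 n.+1 open_col.+1 close_col.

End OneNeg.

Definition Epar n (A : 'M[int]_n) : int :=
  if is_negative A then - charge (vrefl A)
  else if is_positive A then charge A else 0.

Definition Bpn n (A : 'M[int]_n) : int := cpar A - lpar A.
Definition Jpn n (A : 'M[int]_n) : int := cpar A + lpar A + `|Epar A| + 1.
Definition Bpar n (A : 'M[int]_n) : int :=
  if is_negative A then - Bpn (vrefl A) else Bpn A.
Definition Jpar n (A : 'M[int]_n) : int :=
  if is_negative A then Jpn (vrefl A) else Jpn A.

(* Horizontal and vertical displacements of an m x q matrix P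
   (given as a 1-based function) *)

Definition nz_cols (P : mat) (m q : nat) : seq nat :=
  [seq j <- iota 1 q | has (fun i => P i j != 0) (iota 1 m)].
Definition nz_rows (P : mat) (m q : nat) : seq nat :=
  [seq i <- iota 1 m | has (fun j => P i j != 0) (iota 1 q)].

(* column j_{s+1} of H(P) is column j_s of P (j_{t+1} = q), others zero *)
Definition Hdisp (P : mat) (m q : nat) : mat := fun i j =>
  let js := nz_cols P m q in
  let js' := rcons (behead js) q in
  if j \in js' then P i (nth 0%N js (index j js')) else 0.

(* row i_{s-1} of V(P) is row i_s of P (i_0 = 1), others zero *)
Definition Vdisp (P : mat) (m q : nat) : mat := fun i j =>
  let is_ := nz_rows P m q in
  let is' := belast 1%N is_ in
  if i \in is' then P (nth 0%N is_ (index i is')) j else 0.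

Section Discharge.
Variables (n : nat) (A : 'M[int]_n).
Let o := open_row A.
Let p := close_row A.
Let q := open_col A.
Let c := close_col A.

Definition dstep1 (M : mat) : mat := fun i j =>
  if ((i == p) && (j == q)) || ((i == p) && (j == c)) then 0 else M i j.

Definition dstep2 (M : mat) : mat := fun i j =>
  if (p < i <= n)%N && (q <= j <= c)%N then
    Hdisp (fun i' j' => M (p + i')%N (q.-1 + j')%N) (n - p) (c - q).+1
          (i - p)%N (j - q).+1
  else M i j.

Definition dstep3 (M : mat) : mat := fun i j =>
  if (o <= i <= p)%N && (1 <= j < q)%N then
    Vdisp (fun i' j' => M (o.-1 + i')%N j') (p - o).+1 q.-1 (i - o).+1 j
  else M i j.

Definition dstep4 (M : mat) : mat := fun i j =>
  if (1 <= j < q)%N && (o <= i <= p)%N then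
    (if i == o then 0 else M i.-1 j)
  else if (q < j <= n)%N && (o < i <= p)%N then
    (if i == o.+1 then 0 else M i.-1 j)
  else M i j.

Definition delta : 'M[int]_n := of_mat n (dstep4 (dstep3 (dstep2 (dstep1 (ent A))))).

Definition Delta : nat * 'M[int]_n * int * int := (o, delta, cpar A, Epar A).

End Discharge.

(* Neutralizing procedure Lambda, given as its graph:
   [Lambda_graph A N E] means Lambda(A) = (N, E).  *)

Definition Lambda_pn n (A N : 'M[int]_n) (E : int) : bool :=
  [&& in_ASM 1 N, is_positive N || is_neutral N,
      Delta N == (open_row A, delta A, cpar A + Epar A, 0) & E == Epar A].

Definition Lambda_graph n (A N : 'M[int]_n) (E : int) : bool :=
  if is_negative A then Lambda_pn (vrefl A) (vrefl N) (- E) else Lambda_pn A N E.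

Definition git_k n (N : 'M[int]_n) : nat := (n.+1 - open_row N)%N.
Definition git_a n (N : 'M[int]_n) (i : nat) : int :=
  let r := (n.+1 - i)%N in cellsum (ent N) r.+1 n.+1 1 (one_col N r).
Definition git_b n (N : 'M[int]_n) : int := cpar N.
Definition git_beta n (N : 'M[int]_n) (E : int) : int := E + lpar N.

Inductive step := stE | stF | stS | stN.
Definition step_eqb (s t : step) : bool :=
  match s, t with
  | stE, stE | stF, stF | stS, stS | stN, stN => true | _, _ => false end.
Lemma step_eqP : Equality.axiom step_eqb.
Proof. by case; case; constructor. Qed.
HB.instance Definition _ := hasDecEq.Build step step_eqP.

Definition pt := (int * int)%type.
Definition step_vec (s : step) : pt :=
  match s with stE => (1, 0) | stF => (1, 0) | stS => (0, -1) | stN => (1, 1) end.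
Definition move (v : pt) (s : step) : pt := (v.1 + (step_vec s).1, v.2 + (step_vec s).2).

Definition path := (pt * seq step)%type.

Fixpoint walk (v : pt) (w : seq step) : seq (pt * step) :=
  if w is s :: w' then (v, s) :: walk (move v s) w' else [::].
Definition psteps (P : path) : seq (pt * step) := walk P.1 P.2.
Definition endpt (v : pt) (w : seq step) : pt := foldl move v w.

Definition is_left_step (s : step) : bool := (s == stS) || (s == stE).
Definition junction (P : path) : pt := endpt P.1 (take (find (predC is_left_step) P.2) P.2).

Definition all_steps (Om : seq path) : seq (pt * step) := flatten (map psteps Om).

Definition toN (x : int) : nat := if x is Posz m then m else 0%N.

Definition phi_word n (N : 'M[int]_n) (E : int) (i : nat) : seq step :=
  let k := git_k N in
  let a := git_a N in
  let b := git_b N in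
  let beta := git_beta N E in
  if i == k.-1 then
    nseq (toN (a i)) stE ++ nseq (toN beta) stF ++ [:: stN]
      ++ nseq (toN ((k%:Z - 2) - a i - beta)) stF
  else if i == k then
    nseq (toN (a i)) stE ++ [:: stS] ++ nseq (toN b) stE
      ++ nseq (toN ((k%:Z - 2) - a i - b)) stF
  else nseq (toN (a i)) stE ++ nseq (toN ((i%:Z - 1) - a i)) stF.

Definition Phi n (N : 'M[int]_n) (E : int) : seq path :=
  [seq ((0, i%:Z), phi_word N E i) | i <- iota 1 n].

Definition omega (Om : seq path) (i : nat) : path := nth ((0, 0), [::]) Om i.-1.

(* Main.v *)
Require Import Defs.
From HB Require Import structures.
From mathcomp Require Import all_boot all_order all_algebra.
From mathcomp Require Import zify ring.
Set Implicit Arguments.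
Unset Strict Implicit.
Unset Printing Implicit Defensive.
Import Order.TTheory GRing.Theory Num.Theory.
Local Open Scope ring_scope.

(* The matrix A is encoded by the column X i of the leftmost 1 of each row i, so that
   a_{ij} = [j = X i] + [i = p]([j = c] - [j = q]), where p is the closing row, q the opening
   column and c the closing column.  The partial discharge P = delta(A) is the permutation
   matrix obtained by sending the 1 at (i, X i) to (new_row i, new_col i): new_row permutes the
   rows o < i <= p, preserving the order among left rows and among right rows, and new_col
   shifts columns increasingly below row p.  Counting inversions, the two shifts contribute
   telescoping sums, which give i(A) = i(P) + E + c(A) + 1 with E the charge of A; moreover
   l(A) and r(A) can be read off from P and the opening row o.  Since A and N = Lambda(A) have
   the same o and P, and c(N) = c(A) + E(A), all the invariants of A and N compare as claimed.
   Negative matrices are treated by reflection: i(A) + i(vrefl A) depends on n only, and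
   reflection exchanges c and l on neutral matrices. *)

(** * Structure of the matrices with one -1 *)

(* X i is the column of the leftmost 1 of row i, and u the row of the 1 of the opening column
   below the -1. *)
Record asm1 (n o p q c u : nat) (X : nat -> nat) (a : mat) : Prop := Asm1 {
  asm1_open : (0 < o < p)%N;
  asm1_low : (p < u <= n)%N;
  asm1_left : (0 < X p < q)%N;
  asm1_close : (q < c <= n)%N;
  asm1_range : forall i, (0 < i <= n)%N -> (0 < X i <= n)%N;
  asm1_Xo : X o = q;
  asm1_Xu : X u = q;
  asm1_Xq : forall i, (0 < i <= n)%N -> X i = q -> i = o \/ i = u;
  asm1_Xc : forall i, (0 < i <= n)%N -> X i <> c;
  asm1_inj : forall i i', (0 < i <= n)%N -> (0 < i' <= n)%N ->
    X i = X i' -> X i <> q -> i = i';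
  asm1_ent : forall i j, (0 < i <= n)%N -> (0 < j <= n)%N ->
    a i j = (j == X i)%:Z + (i == p)%:Z * ((j == c)%:Z - (j == q)%:Z);
  asm1_colsum : forall j, (0 < j <= n)%N -> \sum_(1 <= i < n.+1) a i j = 1 }.

Lemma sum_pick n x (F : nat -> int) : (0 < x <= n)%N ->
  \sum_(1 <= j < n.+1) (j == x)%:Z * F j = F x.
Proof.
move=> hx; rewrite (bigD1_seq x) ?mem_index_iota ?iota_uniq //= eqxx mul1r.
by rewrite big1 ?addr0 // => j /negPf ->; rewrite mul0r.
Qed.

Lemma eq_sum_nat1 n (F G : nat -> int) :
  (forall r, (0 < r <= n)%N -> F r = G r) ->
  \sum_(1 <= r < n.+1) F r = \sum_(1 <= r < n.+1) G r.
Proof. by move=> h; apply: eq_big_nat. Qed.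

Lemma entE n (A : 'M[int]_n) (i j : 'I_n) : ent A i.+1 j.+1 = A i j.
Proof. by rewrite /ent /= !valK. Qed.

Lemma map_enum_ord1 n (f : nat -> int) :
  [seq f j.+1 | j : 'I_n <- enum 'I_n] = [seq f j | j <- iota 1 n].
Proof.
rewrite (iotaDl 1 0 n) -map_comp -val_enum_ord -map_comp.
exact: eq_map.
Qed.

Lemma mem_filter_iota1 n (P : pred nat) j :
  (j \in [seq j <- iota 1 n | P j]) = P j && (0 < j <= n)%N.
Proof. by rewrite mem_filter mem_iota add1n ltnS. Qed.

Lemma alt_seq_nth s k : alt_seq s -> (k < size s)%N -> nth 0 s k = (-1) ^+ k.
Proof.
by case/andP=> _ /allP h hk; apply/eqP/h; rewrite mem_iota.
Qed.

(** A second nonzero entry would be -1 by alternation, so only the leading 1 remains. *)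
Lemma alt_line1 n (f : nat -> int) :
  alt_seq [seq x <- [seq f j | j <- iota 1 n] | x != 0] ->
  (forall j, (0 < j <= n)%N -> f j <> -1) ->
  exists2 x, (0 < x <= n)%N & forall j, (0 < j <= n)%N -> f j = (j == x)%:Z.
Proof.
rewrite filter_map => h hf.
have hm j : (j \in [seq j <- iota 1 n | f j != 0]) = (f j != 0) && (0 < j <= n)%N.
  exact: mem_filter_iota1.
move: h hm; rewrite [filter _ _](_ : _ = [seq j <- iota 1 n | f j != 0]) //.
case: [seq j <- iota 1 n | f j != 0] => [//|x [|y t]] h hm.
  exists x; first by have := hm x; rewrite inE eqxx => /esym/andP[].
  move=> j hj; have := hm j; rewrite inE hj andbT.
  case: eqP => [->|_] /=; last by move/esym/negbFE/eqP.
  by move=> _; exact: (@alt_seq_nth _ 0 h).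
have /andP[_ hy] : (f y != 0) && (0 < y <= n)%N by rewrite -hm !inE eqxx orbT.
by case: (hf y hy); exact: (@alt_seq_nth _ 1 h).
Qed.

(** The second nonzero entry is -1 and so sits at [q]; a fourth would be a -1 at [q] again. A single
    entry cannot be the -1, so odd length leaves exactly three. *)
Lemma alt_line3 n (f : nat -> int) q :
  alt_seq [seq x <- [seq f j | j <- iota 1 n] | x != 0] ->
  (0 < q <= n)%N -> f q = -1 ->
  (forall j, (0 < j <= n)%N -> f j = -1 -> j = q) ->
  exists d c, [/\ (0 < d < q)%N, (q < c <= n)%N &
    forall j, (0 < j <= n)%N ->
      f j = (j == d)%:Z + ((j == c)%:Z - (j == q)%:Z)].
Proof.
rewrite filter_map => h hq fq hf.
have hm j : (j \in [seq j <- iota 1 n | f j != 0]) = (f j != 0) && (0 < j <= n)%N.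
  exact: mem_filter_iota1.
have hs : sorted ltn [seq j <- iota 1 n | f j != 0].
  by rewrite sorted_filter ?iota_ltn_sorted //; exact: ltn_trans.
move: h hm hs; rewrite [filter _ _](_ : _ = [seq j <- iota 1 n | f j != 0]) //.
case: [seq j <- iota 1 n | f j != 0] => [|d [|q' [|c t]]] // h hm hs.
  have := hm q; rewrite inE fq hq /= => /eqP eq; move: fq; rewrite eq.
  by have := @alt_seq_nth _ 0 h isT => /= ->.
have q'E : q' = q.
  apply: hf; last exact: (@alt_seq_nth _ 1 h).
  by have := hm q'; rewrite !inE eqxx orbT => /esym/andP[].
rewrite {}q'E in h hm hs.
case: t h hm hs => [|z t] h hm hs; last first.
  have e : z = q.
    apply: hf; last exact: (@alt_seq_nth _ 3 h).
    by have := hm z; rewrite !inE eqxx !orbT => /esym/andP[].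
  by move: hs; rewrite e /= => /and4P[_ h1 h2 _]; lia.
move: hs => /= /and3P[hdq hqc _].
have fd : f d = 1 by exact: (@alt_seq_nth _ 0 h).
have fc : f c = 1 by exact: (@alt_seq_nth _ 2 h).
exists d, c; split.
- by have := hm d; rewrite !inE eqxx /= => /esym/andP[_]; lia.
- by have := hm c; rewrite !inE eqxx !orbT /= => /esym/andP[_]; lia.
move=> j hj; have := hm j; rewrite !inE hj andbT.
case: (eqVneq j d) => [->|ed].
  by rewrite fd => _; lia.
case: (eqVneq j q) => [->|eq].
  by rewrite fq => _; lia.
case: (eqVneq j c) => [->|ec]; first by rewrite fc; lia.
by move=> /esym/negbFE/eqP ->.
Qed.

(** This evaluates the [head] or [last] of a filtered range once the index is known to be unique. *)
Lemma filter_iota_pred1 m n (P : pred nat) x :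
  (m <= x < m + n)%N -> (forall i, (m <= i < m + n)%N -> P i = (i == x)) ->
  [seq i <- iota m n | P i] = [:: x].
Proof.
move=> hx hP; rewrite -(filter_pred1_uniq (iota_uniq m n)); last by rewrite mem_iota.
by apply: eq_in_filter => i; rewrite mem_iota; exact: hP.
Qed.

Lemma in_ASM1_ent n (A : 'M[int]_n) : in_ASM 1 A ->
  exists p q, [/\ (0 < p <= n)%N, (0 < q <= n)%N,
    forall i j, (0 < i <= n)%N -> (0 < j <= n)%N ->
      (ent A i j == -1) = (i == p) && (j == q),
    forall i, (0 < i <= n)%N ->
      alt_seq [seq x <- [seq ent A i j | j <- iota 1 n] | x != 0] &
    forall j, (0 < j <= n)%N ->
      alt_seq [seq x <- [seq ent A i j | i <- iota 1 n] | x != 0]].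
Proof.
case/andP=> /and3P[_ /forallP hr /forallP hc] /cards1P[[p q] hpq].
exists p.+1, q.+1; split=> //=.
- move=> [//|i] [//|j] /= hi hj.
  rewrite (entE _ (Ordinal hi) (Ordinal hj)).
  have /setP/(_ (Ordinal hi, Ordinal hj)) := hpq.
  by rewrite !inE /= => ->; rewrite xpair_eqE -!val_eqE.
- move=> [//|i] /= hi; have := hr (Ordinal hi).
  rewrite -map_enum_ord1.
  by congr (alt_seq (filter _ _)); apply: eq_map => j; rewrite (entE _ (Ordinal hi)).
- move=> [//|j] /= hj; have := hc (Ordinal hj).
  rewrite -(map_enum_ord1 n (fun i => ent A i j.+1)).
  by congr (alt_seq (filter _ _)); apply: eq_map => i; rewrite (entE _ _ (Ordinal hj)).
Qed.

(** The row and the column through the -1 have the pattern 1, -1, 1 and every other line has a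
    single 1; the fields of [asm1] are read off from these two facts. *)
Lemma in_ASM1_asm1 n (A : 'M[int]_n) : in_ASM 1 A ->
  exists u, asm1 n (open_row A) (close_row A) (open_col A) (close_col A) u
                 (one_col A) (ent A).
Proof.
case/in_ASM1_ent=> p [q [hp hq hneg hrow hcol]].
have a_pq : ent A p q = -1 by apply/eqP; rewrite hneg // !eqxx.
have hcr : close_row A = p.
  rewrite /close_row (@filter_iota_pred1 _ _ _ p) //; try lia.
  move=> i hi; apply/hasP/eqP => [[j]|->].
    by rewrite mem_iota => hj; rewrite hneg ?add1n //; lia.
  by exists q; rewrite ?mem_iota ?a_pq //; lia.
have hoc : open_col A = q.
  rewrite /open_col (@filter_iota_pred1 _ _ _ q) //; try lia.
  move=> j hj; apply/hasP/eqP => [[i]|->].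
    by rewrite mem_iota => hi; rewrite hneg ?add1n //; lia.
  by exists p; rewrite ?mem_iota ?a_pq //; lia.
have [d [c [hd hc hprow]]] : exists d c, [/\ (0 < d < q)%N, (q < c <= n)%N &
    forall j, (0 < j <= n)%N ->
      ent A p j = (j == d)%:Z + ((j == c)%:Z - (j == q)%:Z)].
  apply: alt_line3 => //; first exact: hrow.
  by move=> j hj /eqP; rewrite hneg // => /andP[_ /eqP].
have [o [u [ho hu hqcol]]] : exists d c, [/\ (0 < d < p)%N, (p < c <= n)%N &
    forall i, (0 < i <= n)%N ->
      ent A i q = (i == d)%:Z + ((i == c)%:Z - (i == p)%:Z)].
  apply: alt_line3 => //; first exact: hcol.
  by move=> j hj /eqP; rewrite hneg // => /andP[/eqP].
have hcc : close_col A = c.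
  rewrite /close_col hcr hoc (@filter_iota_pred1 _ _ _ c) //; try lia.
  by move=> j hj; rewrite hprow; lia.
have hor : open_row A = o.
  rewrite /open_row hcr hoc (@filter_iota_pred1 _ _ _ o) //; try lia.
  by move=> j hj; rewrite hqcol; lia.
have hone i : (0 < i <= n)%N -> i <> p -> exists2 x, (0 < x <= n)%N &
    (forall j, (0 < j <= n)%N -> ent A i j = (j == x)%:Z) /\ one_col A i = x.
  move=> hi hip; have [|x hx hix] := alt_line1 (hrow i hi).
    by move=> j hj /eqP; rewrite hneg // => /andP[/eqP].
  exists x => //; split=> //; rewrite /one_col (@filter_iota_pred1 _ _ _ x) //; try lia.
  by move=> j hj; rewrite hix; lia.
(* The closing row has two 1's; [one_col] takes the head of the increasing list, that is, the 1 left
   of the -1. *)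
have honep : one_col A p = d.
  rewrite /one_col.
  rewrite (_ : filter _ _ = [:: d; c]) //.
  have hs : sorted ltn [seq j <- iota 1 n | ent A p j == 1].
    by rewrite sorted_filter ?iota_ltn_sorted //; exact: ltn_trans.
  apply: (irr_sorted_eq ltn_trans ltnn) => //=; first by rewrite andbT; lia.
  move=> j; rewrite mem_filter_iota1 !inE.
  case: (boolP (0 < j <= n)%N) => hj; first by rewrite hprow //; lia.
  by rewrite andbF; lia.
have ha1 i : (0 < i <= n)%N -> ent A i (one_col A i) = 1 /\ (0 < one_col A i <= n)%N.
  move=> hi; case: (eqVneq i p) => [->|/eqP /(hone i hi)[x hx [ex ->]]].
    by rewrite honep hprow; lia.
  by rewrite ex // eqxx.
have hcol1 j : (0 < j <= n)%N -> j <> q -> exists2 x, (0 < x <= n)%N &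
    (forall i, (0 < i <= n)%N -> ent A i j = (i == x)%:Z).
  move=> hj hjq; have [|x hx hix] := @alt_line1 _ (ent A ^~ j) (hcol j hj); last by exists x.
  by move=> i hi /eqP; rewrite hneg // => /andP[_ /eqP].
have ent_E i j : (0 < i <= n)%N -> (0 < j <= n)%N -> ent A i j =
    (j == one_col A i)%:Z + (i == p)%:Z * ((j == c)%:Z - (j == q)%:Z).
  move=> hi hj; case: (eqVneq i p) => [->|/eqP hip]; first by rewrite hprow ?honep //; lia.
  by have [x hx [-> // ->]] := hone i hi hip; lia.
have hinj i i' : (0 < i <= n)%N -> (0 < i' <= n)%N ->
    one_col A i = one_col A i' -> one_col A i <> q -> i = i'.
  move=> hi hi' e eq; have [e1 hx] := ha1 i hi; have [e2 _] := ha1 i' hi'.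
  have [x _ hx'] := hcol1 _ hx eq.
  by move: e1 e2; rewrite -e !hx'; lia.
exists u; rewrite hor hcr hoc hcc; split=> //.
- by rewrite honep.
- by move=> i /ha1[].
- by have := ent_E o q; rewrite hqcol; lia.
- by have := ent_E u q; rewrite hqcol; lia.
- move=> i hi e; case: (eqVneq i p) => [ei|ei].
    by move: e; rewrite ei honep; lia.
  by have := ent_E i q hi; rewrite hqcol; lia.
(* The only 1 of column [c] is the closing 1, in row [p], and the leftmost 1 of row [p] lies left of
   [q]. *)
- move=> i hi e; case: (eqVneq i p) => [ei|ei].
    by move: e; rewrite ei honep; lia.
  have [||x _ hx] := hcol1 c; [lia|lia|].
  have [e1 _] := ha1 i hi; move: e1; rewrite e.
  have := hprow c; rewrite !hx; lia.
- move=> j hj; case: (eqVneq j q) => [->|/eqP nq].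
    rewrite (eq_sum_nat1 (G := fun i => (i == o)%:Z * 1 +
      ((i == u)%:Z * 1 - (i == p)%:Z * 1))) => [|i hi]; last by rewrite hqcol // !mulr1.
    by rewrite big_split sumrB /= !sum_pick //; lia.
  have [x hx hix] := hcol1 j hj nq.
  rewrite (eq_sum_nat1 (G := fun i => (i == x)%:Z * 1)) => [|i hi]; first by rewrite sum_pick.
  by rewrite hix // mulr1.
Qed.

(** * Weighted sums of entries *)

(** The inversion number and the cell sums all take this form, so one evaluation for [asm1] matrices
    and one for their discharges serve every statistic. *)
Definition wsum (n : nat) (a G : mat) : int :=
  \sum_(1 <= i < n.+1) \sum_(1 <= j < n.+1) a i j * G i j.

Lemma eq_wsum n a G G' :
  (forall i j, (0 < i <= n)%N -> (0 < j <= n)%N -> G i j = G' i j) ->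
  wsum n a G = wsum n a G'.
Proof.
move=> h; apply: eq_big_nat => i hi; apply: eq_big_nat => j hj.
by rewrite h.
Qed.

Lemma sum_ord1 n (F : nat -> int) :
  \sum_(i < n) F i.+1 = \sum_(1 <= i < n.+1) F i.
Proof. by rewrite big_add1 /= big_mkord. Qed.

Lemma ipar_wsum n (A : 'M[int]_n) :
  ipar A = wsum n (ent A) (fun i j => wsum n (ent A) (fun k l => ((i < k) && (l < j))%N%:Z)).
Proof.
rewrite /ipar /wsum -sum_ord1; apply: eq_bigr => i _.
rewrite -sum_ord1; apply: eq_bigr => j _.
rewrite -sum_ord1 mulr_sumr; apply: eq_bigr => k _.
rewrite -sum_ord1 mulr_sumr big_mkcond; apply: eq_bigr => l _.
by rewrite !entE !ltnS; case: ifP; rewrite ?mulr1 ?mulr0.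
Qed.

Lemma sum_iv n m k (F : nat -> int) : (0 < m)%N -> (k <= n.+1)%N ->
  \sum_(m <= i < k) F i = \sum_(1 <= i < n.+1) (m <= i < k)%N%:Z * F i.
Proof.
move=> hm hk; rewrite (big_nat_widen _ _ _ _ _ hk) (big_nat_widenl _ _ _ _ _ hm).
rewrite big_mkcond; apply: eq_bigr => i _ /=.
by case: (m <= i)%N; case: (i < k)%N; rewrite /= ?mul1r ?mul0r.
Qed.

Lemma cellsum_wsum n a i1 i2 j1 j2 :
  (0 < i1)%N -> (0 < j1)%N -> (i2 <= n.+1)%N -> (j2 <= n.+1)%N ->
  cellsum a i1 i2 j1 j2 = wsum n a (fun i j => ((i1 <= i < i2) && (j1 <= j < j2))%N%:Z).
Proof.
move=> h1 h2 h3 h4; rewrite /cellsum /wsum (@sum_iv n) //; apply: eq_bigr => i _.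
rewrite (@sum_iv n) // mulr_sumr; apply: eq_bigr => j _.
by case: (i1 <= i < i2)%N; case: (j1 <= j < j2)%N; rewrite ?mul1r ?mul0r ?mulr0 ?mulr1.
Qed.

Section Asm1.
Variables (n o p q c u : nat) (X : nat -> nat) (a : mat).
Hypothesis H : asm1 n o p q c u X a.

Lemma asm1_ranges :
  [/\ (0 < o < p)%N, (p < u <= n)%N, (0 < X p < q)%N & (q < c <= n)%N].
Proof. by case: H. Qed.

Lemma asm1_Xneq i : (0 < i <= n)%N -> i <> o -> i <> u -> X i <> q.
Proof. by move=> hi h1 h2 /(asm1_Xq H hi) []. Qed.

Lemma asm1_wsum G :
  wsum n a G = \sum_(1 <= r < n.+1) G r (X r) + G p c - G p q.
Proof.
have [ho hu hd hc] := asm1_ranges.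
transitivity (\sum_(1 <= i < n.+1)
    (G i (X i) + (i == p)%:Z * (G i c - G i q))); last first.
  by rewrite big_split /= (sum_pick (fun i => G i c - G i q)) ?addrA //; lia.
apply: eq_sum_nat1 => i hi.
transitivity (\sum_(1 <= j < n.+1) ((j == X i)%:Z * G i j +
    (i == p)%:Z * ((j == c)%:Z * G i j - (j == q)%:Z * G i j))).
  by apply: eq_sum_nat1 => j hj; rewrite (asm1_ent H) //; ring.
rewrite big_split /= sum_pick; last exact: (asm1_range H).
by rewrite -mulr_sumr sumrB !sum_pick //; lia.
Qed.

Lemma asm1_inversions i j :
  wsum n a (fun k l => ((i < k) && (l < j))%N%:Z) =
  \sum_(1 <= r < n.+1) ((i < r) && (X r < j))%N%:Z
  + (i < p)%N%:Z * ((c < j)%N%:Z - (q < j)%N%:Z).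
Proof. by rewrite asm1_wsum; case: (i < p)%N => /=; rewrite ?mul1r ?mul0r; lia. Qed.

Lemma asm1_charge : cellsum a o.+1 p q.+1 n.+1 =
  \sum_(1 <= r < n.+1) ((o < r < p) && (q < X r))%N%:Z.
Proof.
have [ho hu hd hc] := asm1_ranges.
rewrite (@cellsum_wsum n); try lia.
rewrite asm1_wsum (_ : (o < p < p)%N = false) /= ?addr0 ?subr0; last lia.
by apply: eq_sum_nat1 => r hr; have := asm1_range H hr; lia.
Qed.

Lemma asm1_closing : cellsum a p.+1 n.+1 q.+1 c =
  \sum_(1 <= r < n.+1) ((p < r) && (q < X r < c))%N%:Z.
Proof.
have [ho hu hd hc] := asm1_ranges.
rewrite (@cellsum_wsum n); try lia.
rewrite asm1_wsum (_ : (p < p < n.+1)%N = false) /= ?addr0 ?subr0; last lia.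
by apply: eq_sum_nat1 => r hr; lia.
Qed.

Lemma asm1_left_cell x y : (0 < x)%N -> (y <= q)%N ->
  cellsum a o.+1 n.+1 x y =
  \sum_(1 <= r < n.+1) ((o < r) && (x <= X r < y))%N%:Z.
Proof.
have [ho hu hd hc] := asm1_ranges.
move=> hx hy; rewrite (@cellsum_wsum n); try lia.
rewrite asm1_wsum (_ : (x <= c < y)%N = false); last lia.
rewrite (_ : (x <= q < y)%N = false) ?andbF /= ?addr0 ?subr0; last lia.
by apply: eq_sum_nat1 => r hr; lia.
Qed.

Lemma asm1_below_left i j : (i <= n)%N -> (0 < j <= n)%N ->
  cellsum a i.+1 n.+1 1 j =
  \sum_(1 <= r < n.+1) ((i < r) && (X r < j))%N%:Z
  + (i < p)%N%:Z * ((c < j)%N%:Z - (q < j)%N%:Z).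
Proof.
move=> hi hj; rewrite (@cellsum_wsum n); try lia.
rewrite -asm1_inversions; apply: eq_wsum => k l hk hl; lia.
Qed.

(** The leftmost 1's give the first sum. The closing 1 minus the -1 counts the 1's below row [p] in
    columns [q] to [c - 1]: those of the closing cell, and the one of row [u] in column [q], whence
    the final 1. *)
Lemma asm1_ipar :
  wsum n a (fun i j => wsum n a (fun k l => ((i < k) && (l < j))%N%:Z)) =
  \sum_(1 <= r < n.+1) cellsum a r.+1 n.+1 1 (X r) + cellsum a p.+1 n.+1 q.+1 c + 1.
Proof.
have [ho hu hd hc] := asm1_ranges.
rewrite asm1_wsum -!addrA; congr (_ + _).
  apply: eq_sum_nat1 => r hr; rewrite asm1_below_left ?asm1_inversions //; try lia.
  exact: (asm1_range H).
rewrite !asm1_inversions ltnn !mul0r !addr0 asm1_closing -sumrB.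
have <- : \sum_(1 <= r < n.+1) (r == u)%:Z * 1 = 1 by rewrite sum_pick //; lia.
rewrite -big_split /=; apply: eq_sum_nat1 => r hr.
case: (eqVneq r u) => [->|ne]; first by rewrite (asm1_Xu H); lia.
case: (eqVneq r o) => [->|ne']; first by lia.
by have := asm1_Xneq hr; lia.
Qed.

End Asm1.

(** * The displacements H and V *)

(** For strictly increasing lists of equal length this is the increasing bijection from [s] to [s'];
    both displacements H and V act through such a bijection. *)
Definition transfer (s s' : seq nat) (x : nat) : nat := nth 0%N s' (index x s).

Section Transfer.
Variables s s' : seq nat.
Hypotheses (ss : sorted ltn s) (ss' : sorted ltn s') (sz : size s = size s').

Lemma mem_transfer x : x \in s -> transfer s s' x \in s'.
Proof. by move=> hx; rewrite mem_nth // -sz index_mem. Qed.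

Lemma transferK x : x \in s -> transfer s' s (transfer s s' x) = x.
Proof.
move=> hx; rewrite /transfer index_uniq ?nth_index // -?sz ?index_mem //.
exact: (sorted_uniq ltn_trans ltnn).
Qed.

Lemma map_transfer : map (transfer s s') s = s'.
Proof.
apply: (@eq_from_nth _ 0%N) => [|i]; rewrite size_map // => hi.
rewrite (nth_map 0%N) // /transfer index_uniq //.
exact: (sorted_uniq ltn_trans ltnn).
Qed.

Lemma transfer_ltn x y : x \in s -> y \in s ->
  (transfer s s' x < transfer s s' y)%N = (x < y)%N.
Proof.
move=> hx hy.
have hn t i j : sorted ltn t -> (i < size t)%N -> (j < size t)%N ->
    (nth 0 t i < nth 0 t j)%N = (i < j)%N.
  move=> st hi hj.
  have mono := sorted_ltn_nth ltn_trans 0%N st.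
  case: (ltngtP i j) => [ij|ji|->]; last exact: ltnn.
    exact: mono.
  by have := mono j i hj hi ji; rewrite /=; lia.
rewrite /transfer hn -?sz ?index_mem // -(hn s) ?index_mem //.
by rewrite !nth_index.
Qed.

End Transfer.

(** [Hdisp] looks up the source of a given target column, while [new_col] gives the target of a
    source; this passes from one to the other. *)
Lemma transfer_eq s s' x y : sorted ltn s -> sorted ltn s' -> size s = size s' ->
  x \in s -> y \in s' -> (transfer s' s y == x) = (y == transfer s s' x).
Proof.
move=> ss ss' sz hx hy; apply/eqP/eqP => [<-|->]; last exact: transferK.
by rewrite transferK.
Qed.

Lemma sum_transfer s s' (F : nat -> int) : sorted ltn s -> size s = size s' ->
  \sum_(x <- s) F (transfer s s' x) = \sum_(x <- s') F x.
Proof. by move=> ss sz; rewrite -[in RHS](map_transfer ss sz) big_map. Qed.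

(** Both lists arise from [x :: s], by removing its first or its last element, so only two terms
    survive. This is the shift performed by V. *)
Lemma sum_belast x s (F : nat -> int) :
  \sum_(y <- s) F y - \sum_(y <- belast x s) F y = F (last x s) - F x.
Proof.
have : \sum_(y <- x :: s) F y = \sum_(y <- rcons (belast x s) (last x s)) F y.
  by rewrite lastI.
rewrite big_cons -cats1 big_cat big_seq1 /=.
move: (\sum_(y <- s) F y) (\sum_(y <- belast x s) F y) => S T; lia.
Qed.

Lemma sorted_filter_iota m n (P : pred nat) : sorted ltn [seq i <- iota m n | P i].
Proof. by rewrite sorted_filter ?iota_ltn_sorted //; exact: ltn_trans. Qed.

Lemma sorted_cons_lower x s : sorted ltn s -> (forall y, y \in s -> (x < y)%N) ->
  sorted ltn (x :: s).
Proof. by case: s => //= y s -> /(_ y); rewrite inE eqxx => ->. Qed.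

Lemma sorted_rcons_upper x s : sorted ltn s -> (forall y, y \in s -> (y < x)%N) ->
  sorted ltn (rcons s x).
Proof.
case: s => //= y s hs h; rewrite rcons_path hs /=; apply: h.
exact: mem_last.
Qed.

Lemma ent_of_mat n (M : mat) i j : (0 < i <= n)%N -> (0 < j <= n)%N ->
  ent (of_mat n M) i j = M i j.
Proof.
case: i j => [//|i] [//|j] /= hi hj.
by rewrite (entE _ (Ordinal hi) (Ordinal hj)) mxE.
Qed.

(** * Occupied columns and rows of the two displaced cells *)

Section Delta.
Variables (n : nat) (A : 'M[int]_n) (u : nat).
Local Notation o := (open_row A).
Local Notation p := (close_row A).
Local Notation q := (open_col A).
Local Notation c := (close_col A).
Local Notation X := (one_col A).
Local Notation M1 := (dstep1 A (ent A)).
Local Notation M2 := (dstep2 A M1).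
Hypothesis H : asm1 n o p q c u X (ent A).

(** Local 1-based coordinates: column 1 of this cell is the opening column and its row 1 lies just
    below the closing row. In [left_cell], row 1 is the opening row. *)
Definition close_cell : mat := fun i j => M1 (p + i)%N (q.-1 + j)%N.
Definition close_cols : seq nat := nz_cols close_cell (n - p) (c - q).+1.
Definition close_cols' : seq nat := rcons (behead close_cols) (c - q).+1.
Definition left_cell : mat := fun i j => M2 (o.-1 + i)%N j.
Definition left_rows : seq nat := nz_rows left_cell (p - o).+1 q.-1.
Definition left_rows' : seq nat := belast 1%N left_rows.

(* The 1 at (r, X r) is moved to (new_row r, new_col r) by delta. *)
Definition new_row (r : nat) : nat :=
  if (o < r <= p)%N then
    if (X r < q)%N then (o + transfer left_rows left_rows' (r - o.-1))%N else r.+1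
  else r.
Definition new_col (r : nat) : nat :=
  if (p < r)%N && (q <= X r <= c)%N then
    (q.-1 + transfer close_cols close_cols' (X r - q.-1))%N
  else X r.

Lemma dstep1_below i j : (p < i <= n)%N -> (0 < j <= n)%N -> M1 i j = (j == X i)%:Z.
Proof.
have [ho hu hd hc] := asm1_ranges H.
move=> hi hj; rewrite /dstep1 (_ : (i == p) = false) /=; last lia.
by rewrite (asm1_ent H) //; lia.
Qed.

Lemma dstep1_left i j : (0 < i <= n)%N -> (0 < j < q)%N -> M1 i j = (j == X i)%:Z.
Proof.
have [ho hu hd hc] := asm1_ranges H.
move=> hi hj; rewrite /dstep1 ifF; last lia.
by rewrite (asm1_ent H) //; lia.
Qed.

Lemma dstep1_above i j : (0 < i < p)%N -> (0 < j <= n)%N -> M1 i j = (j == X i)%:Z.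
Proof.
have [ho hu hd hc] := asm1_ranges H.
move=> hi hj; rewrite /dstep1 ifF; last lia.
by rewrite (asm1_ent H) //; lia.
Qed.

Lemma dstep1_closing j : (q <= j <= n)%N -> M1 p j = 0.
Proof.
have [ho hu hd hc] := asm1_ranges H.
move=> hj; rewrite /dstep1 eqxx /=; case: ifP => // e.
by rewrite (asm1_ent H) //; lia.
Qed.

Lemma dstep2_upper i j : (i <= p)%N -> M2 i j = M1 i j.
Proof. by move=> hi; rewrite /dstep2 ifF //; lia. Qed.

Lemma mem_close_cols x : reflect
  (exists2 r, (p < r <= n)%N & X r = (q.-1 + x)%N /\ (0 < x <= (c - q).+1)%N)
  (x \in close_cols).
Proof.
have [ho hu hd hc] := asm1_ranges H.
rewrite mem_filter_iota1; apply: (iffP andP) => [[/hasP[i]]|].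
  rewrite mem_iota => hi; rewrite /close_cell => hx h.
  exists (p + i)%N; first lia.
  by move: hx; rewrite dstep1_below; lia.
case=> r hr [hX hx]; split=> //; apply/hasP; exists (r - p)%N.
  by rewrite mem_iota; lia.
by rewrite /close_cell subnKC ?dstep1_below ?hX ?eqxx //; lia.
Qed.

Lemma sorted_close_cols : sorted ltn close_cols.
Proof. exact: sorted_filter_iota. Qed.

(** The 1 of row [u] occupies the opening column, as H demands of its first column. *)
Lemma close_colsE : close_cols = 1%N :: behead close_cols.
Proof.
have [ho hu hd hc] := asm1_ranges H.
have h1 : 1%N \in close_cols.
  by apply/mem_close_cols; exists u => //; rewrite (asm1_Xu H); lia.
have := sorted_close_cols.
have h x : x \in close_cols -> (0 < x)%N by case/mem_close_cols=> r _; lia.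
case: close_cols h1 h => //= x s; rewrite inE => /orP[/eqP <-//|h1] h.
rewrite path_sortedE; last exact: ltn_trans.
by have := h x (mem_head _ _) => hx /andP[/allP /(_ _ h1)]; rewrite /=; lia.
Qed.

Lemma size_close_cols : size close_cols = size close_cols'.
Proof. by rewrite size_rcons {1}close_colsE. Qed.

(** Below row [p] the closing column is empty, since its only 1 was the closing 1; so the last local
    column exceeds all the occupied ones. *)
Lemma sorted_close_cols' : sorted ltn close_cols'.
Proof.
have [ho hu hd hc] := asm1_ranges H.
have := sorted_close_cols; rewrite close_colsE => /path_sorted hs.
apply: sorted_rcons_upper => // y /mem_behead/mem_close_cols[r hr [hX hy]].
have := @asm1_Xc _ _ _ _ _ _ _ _ H r; lia.
Qed.

Lemma sum_close_cols (F : nat -> int) :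
  \sum_(x <- close_cols) F x - \sum_(x <- close_cols') F x = F 1%N - F (c - q).+1.
Proof.
have [ho hu hd hc] := asm1_ranges H.
rewrite close_colsE /close_cols' big_cons -cats1 big_cat big_seq1 /=.
by rewrite opprD addrA addrK.
Qed.

Lemma mem_left_rows x :
  (x \in left_rows) = (0 < x <= (p - o).+1)%N && (X (o.-1 + x) < q)%N.
Proof.
have [ho hu hd hc] := asm1_ranges H.
rewrite mem_filter_iota1 andbC; case: (boolP (0 < x <= _)%N) => //= hx.
have hr := @asm1_range _ _ _ _ _ _ _ _ H (o.-1 + x)%N.
apply/hasP/idP => [[j]|h].
  rewrite mem_iota => hj; rewrite /left_cell dstep2_upper ?dstep1_left; lia.
exists (X (o.-1 + x)); first by rewrite mem_iota; lia.
by rewrite /left_cell dstep2_upper ?dstep1_left ?eqxx //; lia.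
Qed.

(** The 1 of the opening row lies in column [q], so the left part of local row 1 is zero, as V
    demands. *)
Lemma sorted_left_rows1 : sorted ltn (1%N :: left_rows).
Proof.
have [ho hu hd hc] := asm1_ranges H.
apply: sorted_cons_lower => [|y]; first exact: sorted_filter_iota.
rewrite mem_left_rows => /andP[hy hX]; case: (eqVneq y 1%N) => [e|]; last lia.
by move: hX; rewrite e addn1 prednK ?(asm1_Xo H); lia.
Qed.

Lemma sorted_left_rows : sorted ltn left_rows.
Proof. exact: path_sorted sorted_left_rows1. Qed.

Lemma sorted_left_rows' : sorted ltn left_rows'.
Proof.
have [ho hu hd hc] := asm1_ranges H.
have := sorted_left_rows1; rewrite lastI -cats1.
by case/cat_sorted2.
Qed.

Lemma size_left_rows : size left_rows = size left_rows'.
Proof. by rewrite size_belast. Qed.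

(** The closing row has a 1 in the left side, so the last row of the cell is occupied. *)
Lemma last_left_rows : last 1%N left_rows = (p - o).+1.
Proof.
have [ho hu hd hc] := asm1_ranges H.
have hp : (p - o).+1 \in left_rows.
  rewrite mem_left_rows (_ : o.-1 + _ = p)%N; lia.
apply/eqP; rewrite eqn_leq; apply/andP; split.
  have := mem_last 1%N left_rows; rewrite inE => /orP[/eqP ->//|].
  by rewrite mem_left_rows => /andP[/andP[]].
have := sorted_left_rows1; have := hp.
case/splitPr: hp => s t _; rewrite last_cat /= cat_path /= => /and3P[_ _].
move/(order_path_min ltn_trans)/allP => h.
have := mem_last (p - o).+1 t; rewrite inE => /orP[/eqP ->//|/h /=]; lia.
Qed.

Lemma mem_left_rows' y : y \in left_rows' ->
  (0 < y <= p - o)%N /\ (y = 1%N \/ y \in left_rows).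
Proof.
have [ho hu hd hc] := asm1_ranges H.
move=> hy; have hy1 : y \in 1%N :: left_rows by rewrite lastI mem_rcons inE hy orbT.
have : (y < last 1 left_rows)%N.
  have := sorted_left_rows1; rewrite lastI.
  move: hy; rewrite -/left_rows'; case/splitPr=> s t.
  rewrite -cats1 -catA cat_cons => /cat_sorted2[_] /=.
  move/(order_path_min ltn_trans)/allP; apply.
  by rewrite mem_cat mem_head orbT.
rewrite last_left_rows => hlt; move: hy1; rewrite inE => /orP[/eqP ->|h].
  by split; [lia|left].
by split; [move: h; rewrite mem_left_rows; lia|right].
Qed.

End Delta.

(** The change of variable [x = g r] carries sums over a list of lines back to sums over the rows of
    the matrix. *)
Lemma sum_reindex n (s : seq nat) (P : pred nat) (g : nat -> nat) (F : nat -> int) :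
  uniq s ->
  (forall r r', (0 < r <= n)%N -> (0 < r' <= n)%N -> P r -> P r' -> g r = g r' -> r = r') ->
  (forall x, reflect (exists2 r, (0 < r <= n)%N & P r /\ x = g r) (x \in s)) ->
  \sum_(1 <= r < n.+1) (P r)%:Z * F (g r) = \sum_(x <- s) F x.
Proof.
move=> us gi hs; transitivity (\sum_(r <- [seq r <- index_iota 1 n.+1 | P r]) F (g r)).
  by rewrite big_filter [in RHS]big_mkcond; apply: eq_bigr => r _; case: (P r); rewrite ?mul1r ?mul0r.
have hm r : (r \in [seq r <- index_iota 1 n.+1 | P r]) = P r && (0 < r <= n)%N.
  by rewrite mem_filter mem_index_iota ltnS.
rewrite -(big_map g predT); apply: perm_big; apply: uniq_perm => //.
  rewrite map_inj_in_uniq ?filter_uniq ?iota_uniq // => r r'.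
  by rewrite !hm => /andP[h1 h2] /andP[h3 h4]; exact: gi.
move=> x; apply/mapP/hs => [[r]|[r hr [hP e]]].
  by rewrite hm => /andP[h1 h2] e; exists r.
by exists r => //; rewrite hm hP.
Qed.

(** * The partial discharge as a permutation matrix *)

Section DeltaPermutation.
Variables (n : nat) (A : 'M[int]_n) (u : nat).
Local Notation o := (open_row A).
Local Notation p := (close_row A).
Local Notation q := (open_col A).
Local Notation c := (close_col A).
Local Notation X := (one_col A).
Local Notation M1 := (dstep1 A (ent A)).
Local Notation M2 := (dstep2 A M1).
Hypothesis H : asm1 n o p q c u X (ent A).

Lemma new_row_out r : ~~ (o < r <= p)%N -> new_row A r = r.
Proof. by rewrite /new_row => /negPf ->. Qed.

Lemma new_row_right r : (o < r <= p)%N -> (q <= X r)%N -> new_row A r = r.+1.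
Proof. by rewrite /new_row => ->; rewrite leqNgt => /negPf ->. Qed.

(** V places the row at local row [y], that is row [o.-1 + y], and the lowering step of the
    discharge moves it to [o + y]. *)
Lemma new_row_left r : (o < r <= p)%N -> (X r < q)%N ->
  exists2 y, y \in left_rows' A &
    y = transfer (left_rows A) (left_rows' A) (r - o.-1) /\ new_row A r = (o + y)%N.
Proof.
move=> hr hX; exists (transfer (left_rows A) (left_rows' A) (r - o.-1)).
  apply: mem_transfer; first exact: size_left_rows.
  have [ho hu hd hc] := asm1_ranges H.
  by rewrite (mem_left_rows H) (_ : (o.-1 + _)%N = r); lia.
by rewrite /new_row hr hX.
Qed.

Lemma mid_right r : (o < r <= p)%N -> ~~ (X r < q)%N -> (q < X r)%N /\ (r < p)%N.
Proof.
move=> hr hX; have [ho hu hd hc] := asm1_ranges H.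
have hrp : r <> p by move=> e; move: hX; rewrite e; lia.
have := asm1_Xneq H (i := r); lia.
Qed.

Lemma new_row_mid r : (o < r <= p)%N -> (o < new_row A r <= p)%N.
Proof.
move=> hr; have [ho hu hd hc] := asm1_ranges H.
case: (boolP (X r < q)%N) => [hX|hX].
  have [y hy [_ ->]] := new_row_left hr hX.
  have [hy1 _] := mem_left_rows' H hy; lia.
by have := mid_right hr hX; rewrite new_row_right //; lia.
Qed.

Lemma new_row_left_ltn r s : (o < r <= p)%N -> (o < s <= p)%N ->
  (X r < q)%N -> (X s < q)%N -> (new_row A r < new_row A s)%N = (r < s)%N.
Proof.
move=> hr hs hXr hXs; have [ho hu hd hc] := asm1_ranges H.
rewrite /new_row hr hs hXr hXs ltn_add2l transfer_ltn; first lia.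
- exact: (sorted_left_rows H).
- exact: (sorted_left_rows' H).
- exact: size_left_rows.
- by rewrite (mem_left_rows H) (_ : (o.-1 + _)%N = r); lia.
- by rewrite (mem_left_rows H) (_ : (o.-1 + _)%N = s); lia.
Qed.

(** V moves a left row to the place of the preceding left row, or of the opening row for the first
    one; lowering then puts it just below that place. *)
Lemma new_row_left_pred r : (o < r <= p)%N -> (X r < q)%N ->
  (o <= (new_row A r).-1 < p)%N /\ ((new_row A r).-1 = o \/ (X (new_row A r).-1 < q)%N).
Proof.
move=> hr hX; have [ho hu hd hc] := asm1_ranges H.
have [y hy [_ ->]] := new_row_left hr hX.
have [hy1 [->|]] := mem_left_rows' H hy; first by split; [lia|left; lia].
rewrite (mem_left_rows H) => /andP[_].
by rewrite (_ : o.-1 + y = (o + y).-1)%N; [split; [lia|right]|lia].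
Qed.

Lemma new_row_inj r s : (0 < r <= n)%N -> (0 < s <= n)%N ->
  new_row A r = new_row A s -> r = s.
Proof.
move=> hr hs; have [ho hu hd hc] := asm1_ranges H.
case: (boolP (o < r <= p)%N) => hrm; case: (boolP (o < s <= p)%N) => hsm.
- case: (boolP (X r < q)%N) => hXr; case: (boolP (X s < q)%N) => hXs.
  + have := new_row_left_ltn hrm hsm hXr hXs; have := new_row_left_ltn hsm hrm hXs hXr.
    lia.
  (* A right row [s] goes to [s.+1], whereas the row above the new place of a left row is the
     opening row or a left row; the two cannot meet. *)
  + have [h1 h2] := mid_right hsm hXs; rewrite (new_row_right hsm) => [e|]; last lia.
    by have := new_row_left_pred hrm hXr; rewrite e /=; lia.
  + have [h1 h2] := mid_right hrm hXr; rewrite (new_row_right hrm) => [e|]; last lia.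
    by have := new_row_left_pred hsm hXs; rewrite -e /=; lia.
  + by rewrite !new_row_right; lia.
- by have := new_row_mid hrm; rewrite (new_row_out hsm); lia.
- by have := new_row_mid hsm; rewrite (new_row_out hrm); lia.
- by rewrite !new_row_out.
Qed.

Lemma new_row_range r : (0 < r <= n)%N -> (0 < new_row A r <= n)%N.
Proof.
move=> hr; have [ho hu hd hc] := asm1_ranges H.
case: (boolP (o < r <= p)%N) => hrm; last by rewrite new_row_out.
by have := new_row_mid hrm; lia.
Qed.

(** Since [(new_row A r).-1] is the left row preceding [r], or [o] for the first, the sum telescopes
    from [o] to the last left row [p]. *)
Lemma new_row_telescope (F : nat -> int) :
  \sum_(1 <= r < n.+1) ((o < r <= p)%N && (X r < q)%N)%:Z * (F r - F (new_row A r).-1)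
  = F p - F o.
Proof.
have [ho hu hd hc] := asm1_ranges H.
have := sum_belast 1%N (left_rows A) (fun x => F (o.-1 + x)%N).
rewrite (last_left_rows H) (_ : (o.-1 + 1)%N = o); last lia.
rewrite (_ : (o.-1 + (p - o).+1)%N = p); last lia.
move=> <-; rewrite -/(left_rows' A).
rewrite -(sum_transfer _ (sorted_left_rows H) (size_left_rows A)) -sumrB.
rewrite -(@sum_reindex n (left_rows A) (fun r => (o < r <= p)%N && (X r < q)%N) (fun r => r - o.-1)%N).
- apply: eq_sum_nat1 => r hr; case: (boolP (_ && _)) => [/andP[hrm hX]|]; last by rewrite !mul0r.
  have [y hy [ey ->]] := new_row_left hrm hX.
  by rewrite -ey; congr (_ * (F _ - F _)); lia.
- exact: (sorted_uniq ltn_trans ltnn (sorted_left_rows H)).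
- by move=> r r' *; lia.
move=> x; apply: (iffP idP) => [|[r hr [/andP[hrm hX] ->]]].
  have := sorted_left_rows1 H => /(order_path_min ltn_trans)/allP /(_ x) /= h1 hx.
  move: (h1 hx); move: hx; rewrite (mem_left_rows H) => /andP[hx hX] h2.
  by exists (o.-1 + x)%N; [lia|split; [rewrite hX andbT; lia|lia]].
by rewrite (mem_left_rows H) (_ : (o.-1 + _)%N = r); lia.
Qed.

Lemma mem_close_cols_row r : (p < r <= n)%N -> (q <= X r <= c)%N ->
  (X r - q.-1)%N \in close_cols A.
Proof.
move=> hr hX; have [ho hu hd hc] := asm1_ranges H.
by apply/(mem_close_cols H); exists r => //; lia.
Qed.

Lemma new_col_upper r : (r <= p)%N -> new_col A r = X r.
Proof. by move=> hr; rewrite /new_col ifF //; lia. Qed.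

Lemma new_col_out r : ~~ (q <= X r <= c)%N -> new_col A r = X r.
Proof. by move=> /negPf hr; rewrite /new_col hr andbF. Qed.

(** H drops local column 1 from the list and appends the last column, so the opening column is
    vacated below row [p]. *)
Lemma new_col_in r : (p < r <= n)%N -> (q <= X r <= c)%N ->
  (q < new_col A r <= c)%N.
Proof.
move=> hr hX; have [ho hu hd hc] := asm1_ranges H.
have := mem_transfer (size_close_cols H) (mem_close_cols_row hr hX).
rewrite /new_col (_ : (p < r)%N) ?hX /=; last lia.
move: (transfer _ _ _) => y.
rewrite mem_rcons inE => /orP[/eqP ->|hy]; first lia.
have : (1 < y)%N.
  have := sorted_close_cols A; rewrite (close_colsE H) /=.
  by move/(order_path_min ltn_trans)/allP; apply.
by have /(mem_close_cols H)[s _ []] := mem_behead hy; lia.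
Qed.

Lemma new_col_range r : (0 < r <= n)%N -> (0 < new_col A r <= n)%N.
Proof.
move=> hr; have [ho hu hd hc] := asm1_ranges H.
have hX := asm1_range H hr.
case: (leqP r p) => hrp; first by rewrite new_col_upper.
case: (boolP (q <= X r <= c)%N) => h; last by rewrite new_col_out.
by have := @new_col_in r; lia.
Qed.

Lemma new_col_ltq r : (0 < r <= n)%N -> (X r < q)%N -> new_col A r = X r.
Proof. by move=> hr hX; rewrite new_col_out //; lia. Qed.

Lemma new_col_geq r : (0 < r <= n)%N -> (q <= X r)%N -> (q <= new_col A r)%N.
Proof.
move=> hr hX; case: (leqP r p) => hrp; first by rewrite new_col_upper.
case: (boolP (q <= X r <= c)%N) => h; last by rewrite new_col_out.
by have := @new_col_in r; lia.
Qed.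

(** Columns from [q] to [c] are shifted increasingly within this interval, and the others are
    fixed. *)
Lemma new_col_ltn r s : (p < r <= n)%N -> (p < s <= n)%N ->
  (new_col A r < new_col A s)%N = (X r < X s)%N.
Proof.
move=> hr hs; have [ho hu hd hc] := asm1_ranges H.
case: (boolP (q <= X r <= c)%N) => hXr; case: (boolP (q <= X s <= c)%N) => hXs.
- rewrite /new_col hXr hXs !andbT !ifT; try lia.
  rewrite ltn_add2l transfer_ltn ?mem_close_cols_row //; first lia.
  + exact: sorted_close_cols.
  + exact: (sorted_close_cols' H).
  + exact: (size_close_cols H).
- by have := new_col_in hr hXr; rewrite (new_col_out hXs); lia.
- by have := new_col_in hs hXs; rewrite (new_col_out hXr); lia.
- by rewrite !new_col_out.
Qed.

(** The occupied columns start at [q]; the new ones are the same list without [q] and with [c]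
    appended. *)
Lemma new_col_telescope (F : nat -> int) :
  \sum_(1 <= r < n.+1) (p < r)%N%:Z * (F (X r) - F (new_col A r)) = F q - F c.
Proof.
have [ho hu hd hc] := asm1_ranges H.
have := sum_close_cols H (fun x => F (q.-1 + x)%N).
rewrite (_ : (q.-1 + 1)%N = q); last lia.
rewrite (_ : (q.-1 + (c - q).+1)%N = c); last lia.
move=> <-.
rewrite -(sum_transfer _ (sorted_close_cols A) (size_close_cols H)) -sumrB.
rewrite -(@sum_reindex n (close_cols A) (fun r => (p < r)%N && (q <= X r <= c)%N) (fun r => X r - q.-1)%N).
- apply: eq_sum_nat1 => r hr; rewrite /new_col.
  case: (boolP (p < r)%N) => hpr /=; last by rewrite !mul0r.
  case: (boolP (q <= X r <= c)%N) => hX; last by rewrite mul0r subrr mulr0.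
  by congr (_ * (F _ - F _)); lia.
- exact: (sorted_uniq ltn_trans ltnn (sorted_close_cols A)).
- move=> r r' hr hr' h1 h2 e.
  (* Only rows [o] and [u] share the column [q], and [o] is not below [p]. *)
  case: (eqVneq (X r) q) => [eq|ne]; last by apply: (asm1_inj H) => //; lia.
  have := asm1_Xq H hr eq; have := @asm1_Xq _ _ _ _ _ _ _ _ H r' hr'; lia.
move=> x; apply: (iffP (mem_close_cols H x)) => [[r hr [e hx]]|[r hr [h ->]]].
  by exists r; [lia|split; lia].
by exists r; [lia|split; lia].
Qed.

Lemma ent_delta i j : (0 < i <= n)%N -> (0 < j <= n)%N ->
  ent (delta A) i j = dstep4 A (dstep3 A M2) i j.
Proof. exact: ent_of_mat. Qed.

Lemma dstep3_out i j : (q <= j)%N || (i < o)%N || (p < i)%N ->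
  dstep3 A M2 i j = M2 i j.
Proof. by move=> h; rewrite /dstep3 ifF //; lia. Qed.

Lemma delta_above r j : (0 < r <= o)%N -> (0 < j <= n)%N ->
  ent (delta A) r j = (j == X r)%:Z.
Proof.
move=> hr hj; have [ho hu hd hc] := asm1_ranges H.
rewrite ent_delta //; last lia.
rewrite /dstep4; case: ifP => h1.
  have e : r = o by lia.
  by rewrite e eqxx (asm1_Xo H); lia.
rewrite ifF ?dstep3_out ?dstep2_upper ?(dstep1_above H) //; lia.
Qed.

Lemma delta_below r j : (p < r <= n)%N -> (0 < j <= n)%N ->
  ent (delta A) r j = (j == new_col A r)%:Z.
Proof.
move=> hr hj; have [ho hu hd hc] := asm1_ranges H.
rewrite ent_delta //; last lia.
rewrite /dstep4 !ifF ?dstep3_out; try lia.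
rewrite /dstep2 /Hdisp; case: ifP => [h1|h1]; last first.
  rewrite (dstep1_below H) //.
  case: (boolP (q <= X r <= c)%N) => hX; last by rewrite new_col_out.
  by have := new_col_in hr hX; lia.
rewrite -/(close_cell A) -/(close_cols A) -/(close_cols' A).
rewrite -/(transfer (close_cols' A) (close_cols A) (j - q).+1).
case: (boolP ((j - q).+1 \in _)) => hjs; last first.
  case: (boolP (q <= X r <= c)%N) => hX; last by rewrite new_col_out //; lia.
  have := mem_transfer (size_close_cols H) (mem_close_cols_row hr hX).
  rewrite /new_col (_ : (p < r)%N) ?hX /=; last lia.
  move: (transfer _ _ _) => y hy; case: eqP => // e.
  by move: hjs; rewrite (_ : (j - q).+1 = y) ?hy //; lia.
have := mem_transfer (esym (size_close_cols H)) hjs.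
case/(mem_close_cols H) => s hs [es hy]; rewrite /close_cell (dstep1_below H); try lia.
rewrite (_ : (p + (r - p))%N = r); last lia.
case: (boolP (q <= X r <= c)%N) => hX; last by rewrite new_col_out //; lia.
have := transfer_eq (sorted_close_cols A) (sorted_close_cols' H) (size_close_cols H)
  (mem_close_cols_row hr hX) hjs.
rewrite /new_col (_ : (p < r)%N) ?hX /=; last lia.
move: (transfer _ _ _) (transfer _ _ _) => y z; lia.
Qed.

(** Columns left of, equal to and right of [q] are treated apart: the left part goes through V and
    the lowering, the right part through the lowering only, and column [q] is untouched. *)
Lemma delta_mid r j : (o < r <= p)%N -> (0 < j <= n)%N ->
  ent (delta A) (new_row A r) j = (j == X r)%:Z.
Proof.
move=> hr hj; have [ho hu hd hc] := asm1_ranges H.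
have hnr := new_row_mid hr.
rewrite ent_delta //; last lia.
rewrite /dstep4; case: ifP => h1.
  rewrite (_ : (new_row A r == o) = false); last lia.
  rewrite /dstep3 ifT; last lia.
  rewrite /Vdisp -/(left_cell A) -/(left_rows A) -/(left_rows' A).
  set i := ((new_row A r).-1 - o).+1.
  rewrite -/(transfer (left_rows' A) (left_rows A) i).
  case: (boolP (X r < q)%N) => hX.
    have [y hy [ey er]] := new_row_left hr hX.
    have -> : i = y by have [hy1 _] := mem_left_rows' H hy; rewrite /i er; lia.
    have hrl : (r - o.-1)%N \in left_rows A.
      by rewrite (mem_left_rows H) (_ : (o.-1 + _)%N = r); lia.
    rewrite hy ey (transferK (sorted_left_rows' H) (size_left_rows A) hrl).
    by rewrite /left_cell (_ : (o.-1 + _)%N = r) ?dstep2_upper ?(dstep1_left H) //; lia.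
  have [hX1 hrp] := mid_right hr hX.
  (* Local row [i] is row [r] itself, a right row strictly below [o], so V leaves zero there. *)
  case: (boolP (i \in _)) => hi; last lia.
  have [hi1 hi2] := mem_left_rows' H hi.
  move: hi2; rewrite (mem_left_rows H) /i new_row_right //; last lia.
  by rewrite /= (_ : (o.-1 + _)%N = r); lia.
case: ifP => h2; last first.
  (* In the rows from [o.+1] to [p] the opening column is zero: the -1 has been removed, and the 1's
     of that column lie in rows [o] and [u]. *)
  have -> : j = q by lia.
  rewrite dstep3_out ?leqnn // dstep2_upper; last lia.
  have hq : (q == X r) = false.
    by case: (boolP (X r < q)%N) => [|/(mid_right hr)]; lia.
  rewrite hq; case: (eqVneq (new_row A r) p) => [->|ne]; first by rewrite (dstep1_closing H); lia.
  rewrite (dstep1_above H); try lia.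
  by have := asm1_Xneq H (i := new_row A r); lia.
case: (boolP (X r < q)%N) => hX; last first.
  have [hX1 hrp] := mid_right hr hX.
  rewrite new_row_right //; last lia.
  rewrite ifF /= ?dstep3_out ?dstep2_upper ?(dstep1_above H) //; lia.
(* If the row above is [o], the lowering puts zero in the right part; otherwise it copies the right
   part of a left row, which is zero. *)
have [hp1 hp2] := new_row_left_pred hr hX.
case: eqP => e; first lia.
rewrite dstep3_out ?dstep2_upper ?(dstep1_above H); lia.
Qed.

Lemma delta_new r j : (0 < r <= n)%N -> (0 < j <= n)%N ->
  ent (delta A) (new_row A r) j = (j == new_col A r)%:Z.
Proof.
move=> hr hj; case: (boolP (o < r <= p)%N) => hrm.
  by rewrite delta_mid // new_col_upper //; lia.
rewrite new_row_out //; case: (leqP r o) => hro.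
  rewrite delta_above ?new_col_upper //; last lia.
  by have [ho hu hd hc] := asm1_ranges H; lia.
by rewrite delta_below //; lia.
Qed.

(** An injective map of a finite range into itself is onto. *)
Lemma new_row_surj x : (0 < x <= n)%N -> exists2 r, (0 < r <= n)%N & x = new_row A r.
Proof.
move=> hx; have : x \in [seq new_row A r | r <- iota 1 n].
  have /uniq_min_size h : uniq [seq new_row A r | r <- iota 1 n].
    rewrite map_inj_in_uniq ?iota_uniq // => r r'; rewrite !mem_iota => h1 h2.
    by apply: new_row_inj; lia.
  have [||_ ->] := h (iota 1 n); rewrite ?size_map ?mem_iota //.
  by move=> y /mapP[r]; rewrite mem_iota => hr ->; rewrite mem_iota; have := @new_row_range r; lia.
by case/mapP=> r; rewrite mem_iota => hr ->; exists r.
Qed.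

Lemma wsum_delta G :
  wsum n (ent (delta A)) G = \sum_(1 <= r < n.+1) G (new_row A r) (new_col A r).
Proof.
rewrite /wsum.
rewrite -(@sum_reindex n (index_iota 1 n.+1) predT (new_row A)
  (fun i => \sum_(1 <= j < n.+1) ent (delta A) i j * G i j)).
- apply: eq_sum_nat1 => r hr; rewrite mul1r.
  rewrite -(sum_pick (G (new_row A r)) (new_col_range hr)).
  by apply: eq_sum_nat1 => j hj; rewrite delta_new.
- exact: iota_uniq.
- by move=> r r' hr hr' _ _; exact: new_row_inj.
move=> x; rewrite mem_index_iota ltnS.
apply: (iffP idP) => [hx|[r hr [_ ->]]]; last exact: new_row_range.
by have [r hr ->] := new_row_surj hx; exists r.
Qed.

End DeltaPermutation.

(** * Statistics and the partial discharge *)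

Section DeltaInvariants.
Variables (n : nat) (A : 'M[int]_n) (u : nat).
Local Notation o := (open_row A).
Local Notation p := (close_row A).
Local Notation q := (open_col A).
Local Notation c := (close_col A).
Local Notation X := (one_col A).
Hypothesis H : asm1 n o p q c u X (ent A).

(* Right rows have one left row fewer below them after the discharge; the -1 and the closing 1
   compensate the column shift below the closing row. *)
Lemma row_inversions_delta r : (0 < r <= n)%N ->
  \sum_(1 <= s < n.+1) ((r < s) && (X s < X r))%N%:Z
    + (r < p)%N%:Z * ((c < X r)%N%:Z - (q < X r)%N%:Z) =
  \sum_(1 <= s < n.+1)
     ((new_row A r < new_row A s) && (new_col A s < new_col A r))%N%:Z
    + ((o < r < p) && (q < X r))%N%:Z.
Proof.
move=> hr; have [ho hu hd hc] := asm1_ranges H.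
have hlow s : (p < s)%N -> new_row A s = s by move=> hs; rewrite new_row_out //; lia.
have hup s : (s <= o)%N -> new_row A s = s by move=> hs; rewrite new_row_out //; lia.
have hmid := @new_row_mid _ _ _ H.
(* Below [p] rows stay in place and columns keep their order, and no row from above moves below
   [p]. *)
case: (ltnP p r) => hpr.
  rewrite (_ : (r < p)%N = false) ?mul0r ?andbF ?addr0 /=; last lia.
  apply: eq_sum_nat1 => s hs; rewrite (hlow r hpr).
  case: (ltnP p s) => hps; first by rewrite hlow ?(new_col_ltn H) //; lia.
  case: (leqP s o) => hso; first by rewrite hup //; lia.
  have hsm : (o < s <= p)%N by rewrite hso.
  by have := hmid s hsm; lia.
rewrite (new_col_upper hpr).
(* Rows [s > p] remain below row [r]; their column shift changes the count by a telescoping sum that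
   cancels the terms in [q] and [c]. [T s] is the change due to a row [s <= p], whose column is
   fixed. *)
pose T s := (s <= p)%N%:Z * (X s < X r)%N%:Z
  * ((r < s)%N%:Z - (new_row A r < new_row A s)%N%:Z).
suff hT : \sum_(1 <= s < n.+1) T s = ((o < r < p) && (q < X r))%N%:Z.
  have := new_col_telescope H (fun y => (y < X r)%N%:Z) => hF.
  (* For [r = p] both sides vanish, as [X p] lies left of [q]. *)
  rewrite (_ : (r < p)%N%:Z * _ = (c < X r)%N%:Z - (q < X r)%N%:Z); last first.
    case: (ltngtP r p) => [_|h|e]; rewrite ?mul1r //; first lia.
    by rewrite e mul0r; lia.
  have -> : (c < X r)%N%:Z - (q < X r)%N%:Z = - ((q < X r)%N%:Z - (c < X r)%N%:Z) :> int.
    by rewrite opprB.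
  rewrite -hF -hT; apply/eqP; rewrite subr_eq -!big_split /=; apply/eqP.
  apply: eq_sum_nat1 => s hs; rewrite /T.
  case: (ltnP p s) => hps; last first.
    rewrite (new_col_upper hps).
    by case: (X s < X r)%N; case: (r < s)%N; case: (new_row A r < new_row A s)%N.
  have h1 : (r < s)%N by lia.
  have h2 : (new_row A r < new_row A s)%N.
    rewrite (hlow s hps); case: (leqP r o) => hro; first by rewrite hup.
    by have := hmid r; lia.
  rewrite h1 h2.
  by case: (X s < X r)%N; case: (new_col A s < X r)%N.
case: (leqP r o) => hro.
  rewrite big1_seq => [|s /andP[_]]; first lia.
  rewrite mem_index_iota => hs; rewrite /T (hup r hro).
  case: (leqP s o) => hso; first by rewrite hup // subrr mulr0.
  case: (leqP s p) => hsp; last by rewrite !mul0r.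
  have hsm : (o < s <= p)%N by rewrite hso.
  have h := hmid s hsm.
  by rewrite (_ : (r < s)%N) 1?(_ : (r < new_row A s)%N) ?subrr ?mulr0 //; lia.
have hrm : (o < r <= p)%N by rewrite hro.
(* For a left row [r], every row with a smaller column has its leftmost 1 on the left as well; such
   rows keep their order relative to [r]. *)
case: (boolP (X r < q)%N) => hX.
  rewrite big1_seq => [|s /andP[_]]; first lia.
  rewrite mem_index_iota => hs; rewrite /T.
  case: (leqP s p) => hsp; last by rewrite !mul0r.
  case: (ltnP (X s) (X r)) => hXs; last by rewrite mulr0 mul0r.
  case: (leqP s o) => hso; last first.
    by rewrite (new_row_left_ltn H) ?hso ?subrr ?mulr0 //; lia.
  rewrite (hup s hso); have := hmid r hrm => h.
  by rewrite (_ : (r < s)%N = false) 1?(_ : (_ < s)%N = false) ?subrr ?mulr0 //; lia.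
(* Right rows all go down by one, so only left rows change their order relative to [r]. Telescoping
   the indicator of [r < y] between [o] and [p] gives the net loss 1. *)
have [hX1 hrp] := mid_right H hrm hX.
rewrite ?hro hrp hX1 /=.
have := new_row_telescope H (fun y => (r < y)%N%:Z); rewrite hrp.
rewrite (_ : (r < o)%N = false) ?subr0; last lia.
move=> <-; apply: eq_sum_nat1 => s hs; rewrite /T new_row_right //; last lia.
case: (leqP s o) => hso.
  rewrite (hup s hso) mul0r (_ : (r < s)%N = false); last lia.
  by rewrite (_ : (r.+1 < s)%N = false) ?subrr ?mulr0 //; lia.
case: (leqP s p) => hsp; last by rewrite !mul0r.
rewrite /= mul1r; case: (boolP (X s < q)%N) => hXs.
  rewrite (_ : (X s < X r)%N) ?mul1r; last lia.
  have hsm : (o < s <= p)%N by rewrite hso.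
  by have := hmid s hsm; lia.
rewrite mul0r new_row_right ?hso //; last lia.
by rewrite ltnS subrr mulr0.
Qed.

(** Summing [row_inversions_delta] over the rows produces the charge; the terms [cpar A + 1] come
    from [asm1_ipar]. *)
Lemma ipar_delta : ipar A = ipar (delta A) + charge A + cpar A + 1.
Proof.
rewrite !ipar_wsum (asm1_ipar H) (wsum_delta H) -/(cpar A).
congr (_ + _ + _); rewrite /charge (asm1_charge H) -big_split /=.
apply: eq_sum_nat1 => r hr.
rewrite (asm1_below_left H) ?(wsum_delta H) ?(row_inversions_delta hr) //; first lia.
exact: (asm1_range H).
Qed.

Lemma lead_rowP : [/\ (o < lead_row A <= p)%N, (X (lead_row A) < q)%N,
  forall r, (o < r <= p)%N -> (X r < q)%N -> (lead_row A <= r)%N &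
  lead_col A = X (lead_row A)].
Proof.
have [ho hu hd hc] := asm1_ranges H.
have hent i j : (0 < i <= n)%N -> (0 < j < q)%N -> ent A i j = (j == X i)%:Z.
  by move=> hi hj; rewrite (asm1_ent H) //; lia.
have hm r : (r \in [seq i <- iota o.+1 (n - o)
    | has (fun j => ent A i j == 1) (iota 1 q.-1)]) = (o < r <= n)%N && (X r < q)%N.
  rewrite mem_filter mem_iota andbC (_ : (_ + _)%N = n.+1) ?ltnS; last lia.
  case: (boolP (o < r <= n)%N) => //= hr; have hX := @asm1_range _ _ _ _ _ _ _ _ H r.
  apply/hasP/idP => [[j]|h]; first by rewrite mem_iota => hj; rewrite hent; lia.
  by exists (X r); rewrite ?mem_iota ?hent ?eqxx //; lia.
have : sorted ltn [seq i <- iota o.+1 (n - o)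
    | has (fun j => ent A i j == 1) (iota 1 q.-1)] by exact: sorted_filter_iota.
have hp : p \in [seq i <- iota o.+1 (n - o)
    | has (fun j => ent A i j == 1) (iota 1 q.-1)] by rewrite hm; lia.
have : lead_row A = head 0%N [seq i <- iota o.+1 (n - o)
    | has (fun j => ent A i j == 1) (iota 1 q.-1)] by [].
case: [seq _ <- _ | _] hm hp => [|x s] hm hp //= elead hs.
have hmin r : r \in x :: s -> (x <= r)%N.
  rewrite inE => /orP[/eqP ->//|]; have /allP h := order_path_min ltn_trans hs.
  by move/h => /=; lia.
have := hm x; rewrite mem_head => /esym/andP[hx hX].
have hXx := asm1_range H (i := x).
have hxp := hmin _ hp.
split; rewrite ?elead //; first lia.
  by move=> r hr hXr; apply: hmin; rewrite hm; lia.
rewrite /lead_col elead (@filter_iota_pred1 _ _ _ (X x)) //; try lia.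
by move=> j hj; rewrite hent; lia.
Qed.

(** The row sent to [o.+1] must be a left row, and by monotonicity it is the first one. Hence the
    leading column can be read in row [o.+1] of the discharge. *)
Lemma new_row_lead : new_row A (lead_row A) = o.+1.
Proof.
have [ho hu hd hc] := asm1_ranges H.
have [hl hXl hmin _] := lead_rowP.
have [|r hr e] := @new_row_surj _ _ _ H o.+1; first lia.
have hrm : (o < r <= p)%N.
  apply: contraT => hrm; move: e; rewrite new_row_out // => e; move: hrm; rewrite -e; lia.
case: (boolP (X r < q)%N) => hX; last first.
  by have [hX1 hX2] := mid_right H hrm hX; move: e; rewrite new_row_right //; lia.
have := hmin r hrm hX; have := new_row_mid H hl.
have := new_row_left_ltn H hl hrm hXl hX.
by case: (ltngtP (lead_row A) r) => [_|//|->]; lia.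
Qed.

Lemma one_col_delta_open : one_col (delta A) o = q.
Proof.
have [ho hu hd hc] := asm1_ranges H.
rewrite /one_col (@filter_iota_pred1 _ _ _ q) //; try lia.
by move=> j hj; rewrite (delta_above H) ?(asm1_Xo H); lia.
Qed.

Lemma one_col_delta_lead : one_col (delta A) o.+1 = lead_col A.
Proof.
have [ho hu hd hc] := asm1_ranges H.
have [hl hXl _ ->] := lead_rowP.
have hX := asm1_range H (i := lead_row A).
rewrite /one_col (@filter_iota_pred1 _ _ _ (X (lead_row A))) //; try lia.
by move=> j hj; rewrite -new_row_lead (delta_mid H) //; lia.
Qed.

Lemma lpar_asm1 : lpar A = \sum_(1 <= r < n.+1) ((o < r) && (lead_col A < X r < q))%N%:Z.
Proof. by rewrite /lpar (asm1_left_cell H). Qed.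

(** Rows below [o] stay below [o], columns left of [q] are fixed and no other column enters the left
    side. The bounds of the cell are read from rows [o] and [o.+1] of the discharge. *)
Lemma lpar_delta : lpar A = cellsum (ent (delta A)) o.+1 n.+1
  (one_col (delta A) o.+1).+1 (one_col (delta A) o).
Proof.
have [ho hu hd hc] := asm1_ranges H.
rewrite one_col_delta_open one_col_delta_lead (@cellsum_wsum n); try lia.
rewrite (wsum_delta H) lpar_asm1; apply: eq_sum_nat1 => r hr.
have -> : (o < r)%N = (o < new_row A r < n.+1)%N.
  have := new_row_range H hr; case: (boolP (o < r <= p)%N) => hrm.
    by have := new_row_mid H hrm; lia.
  by rewrite new_row_out //; lia.
case: (ltnP (X r) q) => hX; first by rewrite new_col_ltq // hX.
by have := new_col_geq H hr hX; lia.
Qed.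

Lemma rpar_delta : rpar A = rpar (delta A).
Proof.
have [ho hu hd hc] := asm1_ranges H.
apply: eq_in_find => j; rewrite mem_iota => hj.
rewrite (delta_above H) ?(asm1_ent H); lia.
Qed.

Lemma rpar_asm1 : (rpar A).+1 = X 1.
Proof.
have [ho hu hd hc] := asm1_ranges H.
have hX := asm1_range H (i := 1%N).
have e : {in iota 1 n, (fun j => ent A 1 j != 0) =1 pred1 (X 1)}.
  move=> j; rewrite mem_iota => hj.
  have -> : pred1 (X 1) j = (j == X 1) by [].
  rewrite (asm1_ent H); try lia.
  by rewrite (_ : (1%N == p) = false) ?mul0r ?addr0; [case: (j == X 1)|lia].
rewrite /rpar (eq_in_find e).
have := @index_uniq _ 0%N (X 1).-1 (iota 1 n).
rewrite nth_iota ?size_iota ?iota_uniq ?add1n ?prednK; try lia.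
rewrite /index => -> //; lia.
Qed.

End DeltaInvariants.

(** * Reflection and neutral matrices *)

(* [vrefl] alone is a lemma of eqtype. *)
Local Notation vrefl := Defs.vrefl.

Lemma vreflK n : involutive (@vrefl n).
Proof. by move=> A; apply/matrixP => i j; rewrite !mxE rev_ordK. Qed.

Lemma ent_vrefl n (A : 'M[int]_n) i j : (0 < i <= n)%N -> (0 < j <= n)%N ->
  ent (vrefl A) i j = ent A i (n.+1 - j)%N.
Proof.
case: i j => [//|i] [//|j] /= hi hj.
rewrite (entE _ (Ordinal hi) (Ordinal hj)) mxE -entE /= subSS.
by congr (ent A _ _); lia.
Qed.

(** As the length is odd, a position has the same parity from either end. *)
Lemma alt_seq_rev s : alt_seq s -> alt_seq (rev s).
Proof.
move=> h; have /andP[ho _] := h; rewrite /alt_seq size_rev ho /=.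
apply/allP => k; rewrite mem_iota /= add0n => hk.
rewrite nth_rev // (alt_seq_nth h); last lia.
by apply/eqP; rewrite -[LHS]signr_odd -[RHS]signr_odd oddB // ho /= negbK.
Qed.

Lemma in_ASM_vrefl n s (A : 'M[int]_n) : in_ASM s A -> in_ASM s (vrefl A).
Proof.
case/andP=> /and3P[/forallP h1 /forallP h2 /forallP h3] /eqP h4.
have hrev : map (@rev_ord n) (enum 'I_n) = rev (enum 'I_n).
  apply: (inj_map val_inj); rewrite map_rev val_enum_ord -map_comp.
  rewrite (eq_map (g := fun i : 'I_n => (n - i.+1)%N)) //.
  rewrite (map_comp (fun i => n - i.+1)%N val) val_enum_ord.
  apply: (@eq_from_nth _ 0%N) => [|i]; rewrite size_map size_iota ?size_rev ?size_iota // => hi.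
  rewrite (nth_map 0%N) ?size_iota // nth_rev ?size_iota // !nth_iota //; lia.
apply/andP; split; first (apply/and3P; split).
- apply/forallP => i; apply/forallP => j; rewrite mxE.
  by have /forallP := h1 i.
- apply/forallP => i.
  rewrite (eq_map (g := fun j => A i (rev_ord j))) => [|j]; last by rewrite mxE.
  by rewrite (map_comp (A i) (@rev_ord n)) hrev map_rev filter_rev alt_seq_rev.
- apply/forallP => j.
  by rewrite (eq_map (g := fun i => A i (rev_ord j))) => [|i]; rewrite ?mxE.
rewrite -h4 /num_neg; apply/eqP.
pose f (ij : 'I_n * 'I_n) := (ij.1, rev_ord ij.2).
have fK : involutive f by case=> i j; rewrite /f /= rev_ordK.
rewrite -(card_imset _ (inv_inj fK)); apply: eq_card => ij; apply/imsetP/idP.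
  by case=> kl; rewrite !inE mxE => hkl ->.
by rewrite inE => hij; exists (f ij); rewrite ?fK // inE mxE /= rev_ordK.
Qed.

Lemma wsum_vrefl n (A : 'M[int]_n) G :
  wsum n (ent (vrefl A)) G = wsum n (ent A) (fun i j => G i (n.+1 - j)%N).
Proof.
apply: eq_sum_nat1 => i hi; rewrite big_nat_rev /=.
apply: eq_sum_nat1 => j hj; rewrite add1n subSS ent_vrefl //; last lia.
by rewrite (_ : (n.+1 - (n.+1 - j))%N = j) //; lia.
Qed.

Lemma asm1_eqN1 n o p q c u X a i j : asm1 n o p q c u X a ->
  (0 < i <= n)%N -> (0 < j <= n)%N -> (a i j == -1) = (i == p) && (j == q).
Proof.
move=> H hi hj; have [ho hu hd hc] := asm1_ranges H; rewrite (asm1_ent H) //.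
case: (eqVneq i p) => [->|ne] /=; last by rewrite mul0r addr0; case: (j == X i).
by rewrite mul1r; lia.
Qed.

Lemma asm1_eq1 n o p q c u X a i j : asm1 n o p q c u X a ->
  (0 < i <= n)%N -> (0 < j <= n)%N ->
  (a i j == 1) = (j == X i) || (i == p) && (j == c).
Proof.
move=> H hi hj; have [ho hu hd hc] := asm1_ranges H; rewrite (asm1_ent H) //.
case: (eqVneq i p) => [->|ne] /=; last by rewrite mul0r addr0 orbF; case: (j == X i).
by rewrite mul1r; lia.
Qed.

Section Reflection.
Variables (n : nat) (A : 'M[int]_n) (u u' : nat).
Local Notation o := (open_row A).
Local Notation p := (close_row A).
Local Notation q := (open_col A).
Local Notation c := (close_col A).
Local Notation X := (one_col A).
Local Notation B := (vrefl A).
Hypothesis H : asm1 n o p q c u X (ent A).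
Hypothesis H' : asm1 n (open_row B) (close_row B) (open_col B) (close_col B) u'
                     (one_col B) (ent B).

Lemma vrefl_close : close_row B = p /\ open_col B = (n.+1 - q)%N.
Proof.
have [ho hu hd hc] := asm1_ranges H; have [ho' hu' hd' hc'] := asm1_ranges H'.
have := @asm1_eqN1 _ _ _ _ _ _ _ _ (close_row B) (open_col B) H'.
rewrite ent_vrefl ?eqxx; try lia.
by rewrite (asm1_eqN1 H); lia.
Qed.

Lemma vrefl_one_col i : (0 < i <= n)%N -> i <> p -> one_col B i = (n.+1 - X i)%N.
Proof.
move=> hi hip; have hX := asm1_range H' hi; have hX' := asm1_range H hi.
have := @asm1_eq1 _ _ _ _ _ _ _ _ i (one_col B i) H'.
rewrite ent_vrefl ?eqxx // (asm1_eq1 H) /=; lia.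
Qed.

Lemma vrefl_open : open_row B = o.
Proof.
have [ho hu hd hc] := asm1_ranges H; have [ho' hu' hd' hc'] := asm1_ranges H'.
have [e1 e2] := vrefl_close.
have := asm1_Xo H'; rewrite vrefl_one_col; try lia.
have := asm1_range H (i := open_row B); have := @asm1_Xq _ _ _ _ _ _ _ _ H (open_row B).
lia.
Qed.

(** Reflection exchanges the two 1's of the closing row, which is why [vrefl_one_col] leaves this
    row aside. *)
Lemma vrefl_closing : one_col B p = (n.+1 - c)%N /\ close_col B = (n.+1 - X p)%N.
Proof.
have [ho hu hd hc] := asm1_ranges H; have [ho' hu' hd' hc'] := asm1_ranges H'.
have [e1 e2] := vrefl_close; rewrite e1 in hd' hu' ho'.
have hX := asm1_range H' (i := p).
have := @asm1_eq1 _ _ _ _ _ _ _ _ p (one_col B p) H'.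
have := @asm1_eq1 _ _ _ _ _ _ _ _ p (close_col B) H'.
rewrite e1 !eqxx orbT /= !ent_vrefl ?(asm1_eq1 H) ?eqxx /=; lia.
Qed.

Lemma rpar_vrefl : (rpar A + rpar B).+1 = n.
Proof.
have [ho hu hd hc] := asm1_ranges H.
have := rpar_asm1 H'; rewrite vrefl_one_col; try lia.
have := asm1_range H (i := 1%N); have := rpar_asm1 H; lia.
Qed.

(** Together the two numbers sum the products over all pairs in distinct rows and distinct columns.
    Row sums are 1, so pairs in distinct rows count the pairs of rows; those in one column total -1,
    all from the pattern 1, -1, 1 of the opening column. *)
Lemma ipar_vrefl : ipar A + ipar B =
  \sum_(1 <= r < n.+1) \sum_(1 <= s < n.+1) (r < s)%N%:Z + 1.
Proof.
have [ho hu hd hc] := asm1_ranges H.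
pose K i j := \sum_(1 <= s < n.+1) ((i < s) && (X s != j))%N%:Z
  + (i < p)%N%:Z * ((c != j)%:Z - (q != j)%:Z).
have -> : ipar A + ipar B = wsum n (ent A) K.
  rewrite !ipar_wsum wsum_vrefl /wsum -big_split /=; apply: eq_sum_nat1 => i hi.
  rewrite -big_split /=; apply: eq_sum_nat1 => j hj; rewrite -mulrDr; congr (_ * _).
  rewrite -/(wsum n (ent A) _) -/(wsum n (ent B) _) wsum_vrefl !(asm1_wsum H) /K.
  have -> : \sum_(1 <= s < n.+1) ((i < s) && (X s != j))%N%:Z =
     \sum_(1 <= s < n.+1) ((i < s) && (X s < j))%N%:Z +
     \sum_(1 <= s < n.+1) ((i < s) && (n.+1 - X s < n.+1 - j))%N%:Z.
    rewrite -big_split /=; apply: eq_sum_nat1 => s hs.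
    by have := asm1_range H hs; lia.
  by case: (i < p)%N; rewrite ?mul1r ?mul0r /=; lia.
rewrite (asm1_wsum H) -addrA; congr (_ + _); last first.
  rewrite /K ltnn !mul0r !addr0 -sumrB.
  have <- : \sum_(1 <= r < n.+1) (r == u)%:Z * 1 = 1 by rewrite sum_pick //; lia.
  apply: eq_sum_nat1 => s hs; have := asm1_Xc H hs.
  case: (eqVneq s u) => [->|ne]; first by rewrite (asm1_Xu H); lia.
  by have := asm1_Xq H hs; lia.
apply: eq_sum_nat1 => r hr; rewrite /K.
(* The correction is nonzero only for [r = o], where it replaces the missing contribution of row
   [u], which has the same column. *)
have -> : (r < p)%N%:Z * ((c != X r)%:Z - (q != X r)%:Z) =
    \sum_(1 <= s < n.+1) (s == u)%:Z * (r == o)%:Z.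
  rewrite (sum_pick (fun=> (r == o)%:Z)); last lia.
  case: (eqVneq r o) => [->|ne]; first by rewrite (asm1_Xo H); lia.
  case: (ltnP r p) => hrp; last by rewrite mul0r.
  by rewrite mul1r; have := asm1_Xc H hr; have := asm1_Xq H hr; lia.
rewrite -big_split /=; apply: eq_sum_nat1 => s hs.
case: (eqVneq r o) => [->|ne] /=.
  rewrite (asm1_Xo H) mulr1; case: (eqVneq s u) => [->|ne]; first by rewrite (asm1_Xu H); lia.
  by have := asm1_Xq H hs; lia.
rewrite mulr0 addr0; case: (ltnP r s) => //= hrs.
case: (eqVneq (X s) (X r)) => //= e.
case: (eqVneq (X s) q) => [eq|/eqP nq]; last by have := asm1_inj H hs hr e nq; lia.
have := asm1_Xq H hs eq; have := asm1_Xq H hr; rewrite -e; lia.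
Qed.

End Reflection.

Lemma sum_iv_ge0 n (b : nat -> bool) : 0 <= \sum_(1 <= r < n.+1) (b r)%:Z :> int.
Proof. by apply: sumr_ge0 => r _; lia. Qed.

(** * Charge, neutral matrices and the inversion table *)

Section Neutral.
Variables (n : nat) (A : 'M[int]_n) (u : nat).
Local Notation o := (open_row A).
Local Notation p := (close_row A).
Local Notation q := (open_col A).
Local Notation c := (close_col A).
Local Notation X := (one_col A).
Hypothesis H : asm1 n o p q c u X (ent A).

Lemma cpar_asm1 : cpar A = \sum_(1 <= r < n.+1) ((p < r) && (q < X r < c))%N%:Z.
Proof. exact: (asm1_closing H). Qed.

Lemma cpar_ge0 : 0 <= cpar A.
Proof. by rewrite cpar_asm1 sum_iv_ge0. Qed.

Lemma lpar_ge0 : 0 <= lpar A.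
Proof. by rewrite (lpar_asm1 H) sum_iv_ge0. Qed.

Lemma charge_asm1 : charge A = \sum_(1 <= r < n.+1) ((o < r < p) && (q < X r))%N%:Z.
Proof. exact: (asm1_charge H). Qed.

Lemma charge_positive : is_positive A -> 0 < charge A.
Proof.
have [ho hu hd hc] := asm1_ranges H.
case/andP=> h1 h2; rewrite charge_asm1 (bigD1_seq p.-1) ?iota_uniq ?mem_index_iota //=.
  rewrite ltr_pwDl //; last by apply: sumr_ge0 => r _; lia.
  by rewrite h2 andbT; lia.
lia.
Qed.

Lemma charge_neutral : is_neutral A -> charge A = 0.
Proof.
move/eqP=> h; rewrite charge_asm1 big1_seq // => r _.
by rewrite (_ : (o < r < p)%N = false) //; lia.
Qed.

(** The 1 of the lowest enclosed row cannot lie in the opening column, whose 1's are in rows [o] and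
    [u]. *)
Lemma not_negative : ~~ is_negative A -> is_positive A || is_neutral A.
Proof.
have [ho hu hd hc] := asm1_ranges H.
rewrite /is_negative /is_positive /is_neutral.
case: (ltnP o.+1 p) => /= h; last lia.
have := @asm1_Xq _ _ _ _ _ _ _ _ H p.-1; lia.
Qed.

Lemma Epar_charge : ~~ is_negative A -> Epar A = charge A.
Proof.
move=> hn; rewrite /Epar (negbTE hn); case: ifP => // hp.
by have := not_negative hn; rewrite hp => /charge_neutral.
Qed.

(** Without enclosed rows the leading row is the closing row, so the leading cell mirrors the
    closing cell. *)
Lemma neutral_lpar : is_neutral A ->
  lpar A = \sum_(1 <= r < n.+1) ((p < r) && (X p < X r < q))%N%:Z.
Proof.
move/eqP=> hn; have [hl _ _ el] := lead_rowP H.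
rewrite (lpar_asm1 H) el (_ : lead_row A = p); last lia.
apply: eq_sum_nat1 => r hr; case: (eqVneq r p) => [->|]; lia.
Qed.

Lemma git_a_below i : (0 < i <= n)%N -> git_a A i =
  \sum_(1 <= s < n.+1) ((n.+1 - i < s) && (X s < X (n.+1 - i)))%N%:Z
  + (n.+1 - i < p)%N%:Z * ((c < X (n.+1 - i))%N%:Z - (q < X (n.+1 - i))%N%:Z).
Proof.
by move=> hi; rewrite /git_a (asm1_below_left H) //; [lia|apply: (asm1_range H); lia].
Qed.

Lemma git_a_ge0 i : (0 < i <= n)%N -> 0 <= git_a A i.
Proof.
have [ho hu hd hc] := asm1_ranges H.
move=> hi; rewrite git_a_below //; move: (n.+1 - i)%N => r.
(* The correction term is charged to row [u], whose 1 in the opening column makes up for the -1. *)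
rewrite -(@sum_pick n u (fun=> _ * _)); last lia.
rewrite -big_split /=; apply: sumr_ge0 => s _.
case: (eqVneq s u) => [->|_]; last by lia.
rewrite mul1r (asm1_Xu H); case: (ltnP r p) => hr; rewrite ?mul1r ?mul0r; lia.
Qed.

Lemma sum_git_a : \sum_(1 <= i < n.+1) git_a A i =
  \sum_(1 <= r < n.+1) cellsum (ent A) r.+1 n.+1 1 (X r).
Proof.
rewrite big_nat_rev /=; apply: eq_sum_nat1 => r hr.
by rewrite /git_a (_ : (n.+1 - _)%N = r) //; lia.
Qed.

Lemma ipar_git : ipar A = \sum_(1 <= i < n.+1) git_a A i + git_b A + 1.
Proof. by rewrite ipar_wsum (asm1_ipar H) sum_git_a. Qed.

(** Each column left of the 1 of the first row has a zero there, so its lower part carries the whole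
    column sum 1. *)
Lemma rpar_git : (rpar A)%:Z = git_a A n.
Proof.
have [ho hu hd hc] := asm1_ranges H.
have hX := asm1_range H (i := 1%N); have hr := rpar_asm1 H.
rewrite /git_a subSnn /cellsum exchange_big /=.
transitivity (\sum_(1 <= j < X 1) 1 : int).
  by rewrite big_const_nat iter_addr_0 -hr subSS subn0 natz.
apply: eq_big_nat => j hj.
have hj' : (0 < j <= n)%N by lia.
have := asm1_colsum H hj'; rewrite [Z in Z = 1 -> _](@big_ltn _ _ _ 1) ?ltnS; last lia.
have -> : ent A 1 j = 0.
  rewrite (asm1_ent H) //; last lia.
  rewrite (_ : (1%N == p) = false) ?mul0r ?addr0; last lia.
  by rewrite (_ : (j == X 1) = false) //; lia.
by rewrite add0r => ->.
Qed.

(** The 1's below [o] and left of [q] are that of row [p] itself, those left of column [X p], and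
    those of the leading cell. *)
Lemma git_a_neutral : is_neutral A ->
  git_a A (git_k A) = git_a A (git_k A).-1 + lpar A + 1.
Proof.
have [ho hu hd hc] := asm1_ranges H.
move=> hn; have /eqP ep := hn.
rewrite !git_a_below /git_k; try lia.
rewrite (_ : (n.+1 - (n.+1 - o))%N = o); last lia.
rewrite (_ : (n.+1 - (n.+1 - o).-1)%N = p); last lia.
rewrite (asm1_Xo H) !ltnn mul0r addr0 (_ : (c < q)%N = false) ?subr0 ?mulr0 ?addr0; last lia.
rewrite (neutral_lpar hn).
have <- : \sum_(1 <= r < n.+1) (r == p)%:Z * 1 = 1 by rewrite sum_pick //; lia.
rewrite -!big_split /=; apply: eq_sum_nat1 => s hs.
case: (eqVneq s p) => [->|ne]; first by lia.
have := @asm1_inj _ _ _ _ _ _ _ _ H s p hs; lia.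
Qed.

End Neutral.

(** * The neutralizing procedure *)

(** The numbers [r] and [l] depend only on the opening row and the discharge, and [i] involves the
    charge and [c] only through their preserved sum. [N] has charge 0, so it is not positive. *)
Lemma Lambda_pnP n (A N : 'M[int]_n) E : in_ASM 1 A -> ~~ is_negative A ->
  Lambda_pn A N E ->
  [/\ in_ASM 1 N, is_neutral N, rpar A = rpar N /\ ipar A = ipar N,
      lpar A = lpar N & [/\ cpar N = cpar A + Epar A, E = Epar A & 0 <= Epar A]].
Proof.
move=> /in_ASM1_asm1[u H] nA /and4P[aN pN /eqP eD /eqP eE].
have [v HN] := in_ASM1_asm1 aN.
have eo : open_row N = open_row A := congr1 (fun t => t.1.1.1) eD.
have ed : delta N = delta A := congr1 (fun t => t.1.1.2) eD.
have ec : cpar N = cpar A + Epar A := congr1 (fun t => t.1.2) eD.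
have e0 : Epar N = 0 := congr1 snd eD.
have nN : ~~ is_negative N.
  by move: pN; rewrite /is_positive /is_neutral /is_negative; lia.
rewrite (Epar_charge HN nN) in e0.
have neN : is_neutral N.
  by case/orP: pN => // /(charge_positive HN); rewrite e0.
have eA := Epar_charge H nA.
split=> //.
- split; first by rewrite (rpar_delta H) (rpar_delta HN) ed.
  by rewrite (ipar_delta H) (ipar_delta HN) ed e0 ec eA; ring.
- by rewrite (lpar_delta H) (lpar_delta HN) ed eo.
- by split=> //; rewrite eA (charge_asm1 H) sum_iv_ge0.
Qed.

Lemma neutral_vrefl n (A : 'M[int]_n) : in_ASM 1 A -> is_neutral A ->
  [/\ is_neutral (vrefl A), lpar (vrefl A) = cpar A & cpar (vrefl A) = lpar A].
Proof.
move=> aA nA; have [u H] := in_ASM1_asm1 aA.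
have [v H'] := in_ASM1_asm1 (in_ASM_vrefl aA).
have [ho hu hd hc] := asm1_ranges H.
have [e1 e2] := vrefl_close H H'; have e3 := vrefl_open H H'.
have [e4 e5] := vrefl_closing H H'.
have nB : is_neutral (vrefl A) by rewrite /is_neutral e1 e3.
split=> //.
  rewrite (neutral_lpar H' nB) (cpar_asm1 H) e1 e2 e4; apply: eq_sum_nat1 => r hr.
  case: (ltnP (close_row A) r) => //= hpr; rewrite (vrefl_one_col H H') //; last lia.
  by have := asm1_range H hr; lia.
rewrite (neutral_lpar H nA) (cpar_asm1 H') e1 e2 e5; apply: eq_sum_nat1 => r hr.
case: (ltnP (close_row A) r) => //= hpr; rewrite (vrefl_one_col H H') //; last lia.
by have := asm1_range H hr; lia.
Qed.

Lemma positive_vrefl n (A : 'M[int]_n) : in_ASM 1 A -> is_negative A ->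
  is_positive (vrefl A).
Proof.
move=> aA /andP[h1 h2]; have [u H] := in_ASM1_asm1 aA.
have [v H'] := in_ASM1_asm1 (in_ASM_vrefl aA).
have [ho hu hd hc] := asm1_ranges H.
have [e1 e2] := vrefl_close H H'; have e3 := vrefl_open H H'.
rewrite /is_positive e1 e2 e3 h1 (vrefl_one_col H H'); lia.
Qed.

Lemma neutral_not_negative n (A : 'M[int]_n) : is_neutral A -> is_negative A = false.
Proof. by rewrite /is_neutral /is_negative; lia. Qed.

Lemma positive_not_negative n (A : 'M[int]_n) : is_positive A -> is_negative A = false.
Proof. by rewrite /is_positive /is_negative; lia. Qed.

Lemma neutral_Epar n (A : 'M[int]_n) : is_neutral A -> Epar A = 0.
Proof.
move=> h; rewrite /Epar neutral_not_negative // ifF //.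
by move: h; rewrite /is_neutral /is_positive; lia.
Qed.

(** In the negative case the invariants are carried back from the reflections. The bound on
    [git_beta] makes it a genuine exponent for [Phi]. *)
Lemma Lambda_graphP n (A N : 'M[int]_n) E : in_ASM 1 A -> Lambda_graph A N E ->
  [/\ in_ASM 1 N, is_neutral N, rpar A = rpar N, ipar A = ipar N &
      [/\ Epar A = E, Bpar A = Bpar N - E, Jpar A = Jpar N & 0 <= git_beta N E]].
Proof.
move=> aA; rewrite /Lambda_graph; case: ifP => [nA|/negbT nA] hL.
  have aB := in_ASM_vrefl aA; have pB := positive_vrefl aA nA.
  have nB := positive_not_negative pB.
  have [aM nM [er ei] el [ec eE hE]] := Lambda_pnP aB (negbT nB) hL.
  have aN : in_ASM 1 N by rewrite -[N]vreflK in_ASM_vrefl.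
  have [nN lN cN] := neutral_vrefl aM nM; rewrite vreflK in nN lN cN.
  have [u H] := in_ASM1_asm1 aA; have [u' H'] := in_ASM1_asm1 aB.
  have [v HN] := in_ASM1_asm1 aN; have [v' HN'] := in_ASM1_asm1 aM.
  have cB : Epar (vrefl A) = charge (vrefl A) by rewrite /Epar nB pB.
  have EA : Epar A = E by rewrite /Epar nA -cB -eE opprK.
  split=> //.
  - apply: (@addIn (rpar (vrefl A))); apply: succn_inj.
    by rewrite (rpar_vrefl H H') er (rpar_vrefl HN HN').
  - have := ipar_vrefl H; rewrite ei -(ipar_vrefl HN); exact: addIr.
  split=> //.
  - rewrite /Bpar nA (neutral_not_negative nN) /Bpn el lN cN ec -eE; ring.
  - rewrite /Jpar nA (neutral_not_negative nN) /Jpn el lN cN ec (neutral_Epar nN).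
    by rewrite normr0 (ger0_norm hE); ring.
  (* Here [- E] is the charge of the reflection of [A], so [beta] equals its number [c]. *)
  - by rewrite /git_beta lN ec -eE addrC subrK (cpar_ge0 H').
have [aN nN [er ei] el [ec eE hE]] := Lambda_pnP aA nA hL.
have [v HN] := in_ASM1_asm1 aN.
split=> //; split=> //.
- by rewrite /Bpar (negbTE nA) (neutral_not_negative nN) /Bpn el ec -eE; ring.
- rewrite /Jpar (negbTE nA) (neutral_not_negative nN) /Jpn el ec (neutral_Epar nN).
  by rewrite normr0 (ger0_norm hE); ring.
- by rewrite /git_beta eE; have := lpar_ge0 HN; lia.
Qed.

(** * Steps of the mixed configuration *)

Lemma toNK x : 0 <= x -> (toN x)%:Z = x.
Proof. by case: x. Qed.

Lemma walk_cat v w1 w2 : walk v (w1 ++ w2) = walk v w1 ++ walk (endpt v w1) w2.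
Proof. by elim: w1 v => //= s w IH v; rewrite IH. Qed.

Lemma endpt_cat v w1 w2 : endpt v (w1 ++ w2) = endpt (endpt v w1) w2.
Proof. exact: foldl_cat. Qed.

Lemma endpt_nseqE x y m : endpt (x, y) (nseq m stE) = (x + m%:Z, y).
Proof.
elim: m x => [|m IH] x /=; first by rewrite addr0.
by rewrite /Defs.move /= addr0 IH; congr (_, _); lia.
Qed.

Lemma endpt_nseqF x y m : endpt (x, y) (nseq m stF) = (x + m%:Z, y).
Proof.
elim: m x => [|m IH] x /=; first by rewrite addr0.
by rewrite /Defs.move /= addr0 IH; congr (_, _); lia.
Qed.

Lemma count_walk (a : pred step) v w : count (fun ps => a ps.2) (walk v w) = count a w.
Proof. by elim: w v => //= s w IH v; rewrite IH. Qed.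

Lemma filter_walk_notin t v w : t \notin w -> [seq ps <- walk v w | ps.2 == t] = [::].
Proof.
elim: w v => //= s w IH v; rewrite inE negb_or eq_sym => /andP[/negPf -> h].
exact: IH.
Qed.

Lemma filter_walk_nseq t s v m : s != t ->
  [seq ps <- walk v (nseq m s) | ps.2 == t] = [::].
Proof.
by move=> h; rewrite filter_walk_notin // mem_nseq eq_sym (negPf h) andbF.
Qed.

Definition isE_at (y : int) : pred (pt * step) := fun ps => (ps.2 == stE) && (ps.1.2 == y).

Lemma count_isE_at_notin y v w : stE \notin w -> count (isE_at y) (walk v w) = 0%N.
Proof.
elim: w v => //= s w IH v; rewrite inE negb_or eq_sym => /andP[hs h].
by rewrite /isE_at /= (negPf hs) IH.
Qed.

Lemma count_isE_at_nseq y v m :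
  count (isE_at y) (walk v (nseq m stE)) = if v.2 == y then m else 0%N.
Proof.
elim: m v => [|m IH] v /=; first by case: ifP.
by rewrite IH /isE_at /Defs.move /= addr0; case: ifP.
Qed.

Lemma junction_cat v l r : all is_left_step l -> all (predC is_left_step) r ->
  junction (v, l ++ r) = endpt v l.
Proof.
move=> hl hr; rewrite /junction /= find_cat.
rewrite has_predC hl /= (_ : find _ r = 0%N) ?addn0 ?take_size_cat //.
by case: r hr => //= s r /andP[-> _].
Qed.

Lemma flatten_single (T : Type) (f : nat -> seq T) x s : uniq s -> x \in s ->
  (forall i, i \in s -> i != x -> f i = [::]) -> flatten [seq f i | i <- s] = f x.
Proof.
elim: s => //= y s IH /andP[hy us]; rewrite inE => /orP[/eqP e|hx] h.
  rewrite e in h *; rewrite (_ : flatten _ = [::]) ?cats0 //.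
  have : forall i, i \in s -> f i = [::].
    move=> i hi; apply: h; first by rewrite inE hi orbT.
    by apply: contraNneq hy => <-.
  elim: (s) => //= z t IHt ht; rewrite ht ?mem_head //= IHt // => i hi.
  by rewrite ht // inE hi orbT.
rewrite (h y) ?mem_head //=; last by apply: contraNneq hy => ->.
by apply: IH => // i hi; apply: h; rewrite inE hi orbT.
Qed.

Lemma sumn_map_iota n (f : nat -> nat) :
  (sumn [seq f i | i <- iota 1 n])%:Z = \sum_(1 <= i < n.+1) (f i)%:Z :> int.
Proof.
rewrite sumnE big_map /index_iota subn1 /=.
by rewrite -[RHS](big_morph Posz PoszD (erefl _)).
Qed.

Section Phi.
Variables (n : nat) (N : 'M[int]_n) (E : int) (u : nat).
Local Notation o := (open_row N).
Local Notation k := (git_k N).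
Local Notation a := (git_a N).
Local Notation b := (git_b N).
Local Notation beta := (git_beta N E).
Hypothesis H : asm1 n o (close_row N) (open_col N) (close_col N) u (one_col N) (ent N).

Lemma git_k_range : (1 < k <= n)%N.
Proof. by have [ho hu hd hc] := asm1_ranges H; rewrite /git_k; lia. Qed.

Lemma omega_Phi i : (0 < i <= n)%N -> omega (Phi N E) i = ((0, i%:Z), phi_word N E i).
Proof.
move=> hi; rewrite /omega /Phi (nth_map 0%N) ?size_iota; last lia.
by rewrite nth_iota ?add1n ?prednK //; lia.
Qed.

Lemma all_steps_Phi :
  all_steps (Phi N E) = flatten [seq walk (0, i%:Z) (phi_word N E i) | i <- iota 1 n].
Proof. by rewrite /all_steps /Phi -map_comp. Qed.

Lemma phi_word_pred : phi_word N E k.-1 = nseq (toN (a k.-1)) stE ++ nseq (toN beta) stF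
  ++ [:: stN] ++ nseq (toN ((k%:Z - 2) - a k.-1 - beta)) stF.
Proof. by rewrite /phi_word eqxx. Qed.

Lemma phi_word_k : phi_word N E k = nseq (toN (a k)) stE ++ [:: stS] ++ nseq (toN b) stE
  ++ nseq (toN ((k%:Z - 2) - a k - b)) stF.
Proof. by have hk := git_k_range; rewrite /phi_word eqxx ifF //; lia. Qed.

Lemma phi_word_other i : i != k -> i != k.-1 ->
  phi_word N E i = nseq (toN (a i)) stE ++ nseq (toN ((i%:Z - 1) - a i)) stF.
Proof. by rewrite /phi_word => /negPf -> /negPf ->. Qed.

(** E-steps keep the height. In path [k] those after the S-step lie at height [k - 1], so they are
    not counted even when [k = n]. *)
Lemma count_top i : (0 < i <= n)%N ->
  count (isE_at n%:Z) (walk (0, i%:Z) (phi_word N E i)) =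
  if i == n then toN (a n) else 0%N.
Proof.
have hk := git_k_range => hi.
have hF m v : count (isE_at n%:Z) (walk v (nseq m stF)) = 0%N.
  by rewrite count_isE_at_notin // mem_nseq andbF.
case: (eqVneq i k.-1) => [->|n1].
  rewrite phi_word_pred !walk_cat !count_cat count_isE_at_nseq !hF /=.
  by rewrite !ifF ?addn0 //; lia.
case: (eqVneq i k) => [->|n2].
  rewrite phi_word_k !walk_cat !count_cat !count_isE_at_nseq hF endpt_nseqE /=.
  have -> : (k%:Z - 1 == n%:Z :> int) = false by lia.
  rewrite !addn0.
  by case: (eqVneq k n) => [->|h]; rewrite ?eqxx // ifF //; lia.
rewrite phi_word_other // walk_cat count_cat hF addn0 count_isE_at_nseq /=.
by case: (eqVneq i n) => [->|h]; rewrite ?eqxx // ifF //; lia.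
Qed.

Lemma count_top_all : (count (isE_at n%:Z) (all_steps (Phi N E)))%:Z = a n.
Proof.
have hk := git_k_range.
rewrite all_steps_Phi count_flatten -map_comp sumn_map_iota.
rewrite (eq_sum_nat1 (G := fun i => (i == n)%:Z * a n)) => [|i hi].
  by rewrite sum_pick //; lia.
rewrite /= count_top //; case: (i == n); rewrite ?mul1r ?mul0r // toNK //.
by apply: (git_a_ge0 H); lia.
Qed.

Lemma count_EN : \sum_(1 <= i < n.+1) a i + b + 1 =
  (count (fun ps : pt * step => (ps.2 == stE) || (ps.2 == stN)) (all_steps (Phi N E)))%:Z.
Proof.
have hk := git_k_range.
rewrite all_steps_Phi count_flatten -map_comp sumn_map_iota.
(* The [b] further E-steps belong to path [k] and the N-step to path [k.-1]; as Kronecker sums they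
   allow a comparison path by path. *)
rewrite -(@sum_pick n k (fun=> b)) 1?[in LHS]addrC; last lia.
rewrite -[X in X + _ = _](@sum_pick n k.-1 (fun=> 1)); last lia.
rewrite -!big_split /=; apply: eq_sum_nat1 => i hi.
rewrite (count_walk (fun s => (s == stE) || (s == stN))).
have hE m : count (fun s => (s == stE) || (s == stN)) (nseq m stE) = m.
  by rewrite count_nseq mul1n.
have hF m : count (fun s => (s == stE) || (s == stN)) (nseq m stF) = 0%N.
  by rewrite count_nseq.
have ha := git_a_ge0 H hi.
case: (eqVneq i k.-1) => [e|n1].
  rewrite e phi_word_pred !count_cat hE !hF /= !PoszD toNK -?e //.
  by rewrite (_ : (i == k) = false); lia.
case: (eqVneq i k) => [e|n2].
  rewrite e phi_word_k !count_cat !hE !hF /= !PoszD !toNK -?e //; first lia.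
  exact: (cpar_ge0 H).
rewrite phi_word_other // count_cat hE hF addn0 toNK //; lia.
Qed.

(** Nonnegativity of [beta] ensures that [toN] does not truncate the number of F-steps before the
    N-step. *)
Lemma filter_stN : 0 <= beta ->
  [seq ps <- all_steps (Phi N E) | ps.2 == stN] =
  [:: ((a k.-1 + beta, k%:Z - 1), stN)].
Proof.
move=> hbeta; have hk := git_k_range.
rewrite all_steps_Phi filter_flatten -map_comp.
rewrite (@flatten_single _ _ k.-1) ?iota_uniq ?mem_iota //=; try lia.
  rewrite phi_word_pred !walk_cat endpt_nseqE endpt_nseqF add0r !toNK //; last first.
    by apply: (git_a_ge0 H); lia.
  rewrite !filter_cat !filter_walk_nseq //=.
  by rewrite (_ : k.-1%:Z = k%:Z - 1) //; lia.
move=> i; rewrite mem_iota => hi n1; rewrite filter_walk_notin //.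
case: (eqVneq i k) => [->|n2].
  by rewrite phi_word_k !mem_cat !mem_nseq !andbF.
by rewrite phi_word_other // !mem_cat !mem_nseq !andbF.
Qed.

Lemma filter_stS : [seq ps <- all_steps (Phi N E) | ps.2 == stS] =
  [:: ((a k, k%:Z), stS)].
Proof.
have hk := git_k_range.
rewrite all_steps_Phi filter_flatten -map_comp.
rewrite (@flatten_single _ _ k) ?iota_uniq ?mem_iota //=; try lia.
  rewrite phi_word_k !walk_cat endpt_nseqE add0r toNK //; last first.
    by apply: (git_a_ge0 H); lia.
  by rewrite !filter_cat !filter_walk_nseq.
move=> i; rewrite mem_iota => hi n1; rewrite filter_walk_notin //.
case: (eqVneq i k.-1) => [->|n2].
  by rewrite phi_word_pred !mem_cat !mem_nseq !andbF.
by rewrite phi_word_other // !mem_cat !mem_nseq !andbF.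
Qed.

Lemma junction_pred : junction (omega (Phi N E) k.-1) = (a k.-1, k%:Z - 1).
Proof.
have hk := git_k_range.
rewrite omega_Phi; last lia.
rewrite phi_word_pred junction_cat; last first.
- by rewrite !all_cat /= !all_nseq /= !orbT.
- by rewrite all_nseq orbT.
rewrite endpt_nseqE add0r toNK; last by apply: (git_a_ge0 H); lia.
by congr (_, _); lia.
Qed.

Lemma junction_k : junction (omega (Phi N E) k) = (a k + b, k%:Z - 1).
Proof.
have hk := git_k_range.
rewrite omega_Phi; last lia.
rewrite phi_word_k catA catA junction_cat; last first.
- by rewrite all_nseq orbT.
- by rewrite !all_cat !all_nseq !orbT.
rewrite !endpt_cat (@endpt_nseqE 0) add0r /= /Defs.move /= endpt_nseqE addr0 !toNK //.
  exact: (cpar_ge0 H).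
by apply: (git_a_ge0 H); lia.
Qed.

End Phi.

Theorem theorem4 (n : nat) (A N : 'M[int]_n) (E : int) :
  in_ASM 1 A -> Lambda_graph A N E ->
  let k := git_k N in
  let a := git_a N in
  let b := git_b N in
  let beta := git_beta N E in
  let Om := Phi N E in
  let isE := fun ps : pt * step => ps.2 == stE in
  let atn := fun ps : pt * step => ps.1.2 == n%:Z in
  [/\
   (* (1) *)
   [/\ rpar A = rpar N, (rpar N)%:Z = a n,
       a n = (count (fun ps => isE ps && atn ps) (all_steps Om))%:Z &
       forall i, (1 <= i <= n)%N -> i != n ->
         count (fun ps => isE ps && atn ps) (psteps (omega Om i)) = 0%N],
   (* (2) *)
   [/\ ipar A = ipar N,
       ipar N = \sum_(1 <= i < n.+1) a i + b + 1 &
       \sum_(1 <= i < n.+1) a i + b + 1 =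
         (count (fun ps : pt * step => (ps.2 == stE) || (ps.2 == stN)) (all_steps Om))%:Z],
   (* (3) *)
   [/\ Epar A = E, E = a k.-1 + beta + 1 - a k &
       exists xN xS : int,
         [/\ [seq ps <- all_steps Om | ps.2 == stN] = [:: ((xN, k%:Z - 1), stN)],
             [seq ps <- all_steps Om | ps.2 == stS] = [:: ((xS, k%:Z), stS)],
             move (xN, k%:Z - 1) stN = (xN + 1, k%:Z) &
             E = (xN + 1) - xS]],
   (* (4) *)
   Bpar A = Bpar N - E /\ Bpar N - E = b - beta &
   (* (5) *)
   [/\ Jpar A = Jpar N, Jpar N = a k - a k.-1 + b &
       exists xa xb : int,
         [/\ junction (omega Om k.-1) = (xa, k%:Z - 1),
             junction (omega Om k) = (xb, k%:Z - 1) &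
             a k - a k.-1 + b = `|xb - xa|]]].
Proof.
move=> aA /(Lambda_graphP aA)[aN nN er ei [eE eB eJ hbeta]] k a b beta Om isE atn.
have [u H] := in_ASM1_asm1 aN.
have ak : a k = a k.-1 + lpar N + 1 := git_a_neutral H nN.
have EE : E = a k.-1 + beta + 1 - a k by rewrite ak /beta /git_beta; ring.
split.
- split=> //; first exact: (rpar_git H).
    exact: esym (count_top_all E H).
  move=> i hi hin; rewrite /Om omega_Phi //.
  by rewrite (count_top E H hi) (negPf hin).
- by split=> //; [exact: (ipar_git H)|exact: (count_EN E H)].
(* These are the abscissas where the N-step and the S-step start; the N-step itself accounts for the
   1 in [EE]. *)
- split=> //; exists (a k.-1 + beta), (a k); split=> //.
  + exact: (filter_stN H hbeta).
  + exact: (filter_stS E H).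
  + by rewrite /Defs.move /= subrK.
- split=> //; rewrite /Bpar neutral_not_negative // /Bpn /b /beta /git_b /git_beta; ring.
split=> //.
  rewrite /Jpar neutral_not_negative // /Jpn neutral_Epar // normr0 ak /b /git_b; ring.
exists (a k.-1), (a k + b); split.
- exact: (junction_pred E H).
- exact: (junction_k E H).
(* The junction of path [k] is the one further right: by [ak] the difference is [lpar N + 1 + b],
   which is positive. *)
rewrite (_ : a k + b - a k.-1 = a k - a k.-1 + b); last ring.
rewrite ger0_norm // ak; have := cpar_ge0 H; have := lpar_ge0 H; rewrite /b /git_b; lia.
Qed.
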